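(* There exist sequences of compatible inductive models of $\mathbf\Delta$.
   Context: The base field is $\mathbb{Q}$. A differential graded Lie algebra (DGL) is a $\mathbb{Z}$-graded Lie algebra $L$ with a linear derivation $\partial$ of degree $-1$, $\partial^2=0$; with $L^1=L$, $L^n=[L,L^{n-1}]$, it is complete if $L\cong\varprojlim_n L/L^n$. ''DGL'' means complete DGL. $\widehat{\mathbb{L}}(V)=\varprojlim_n\mathbb{L}(V)/\mathbb{L}^{>n}(V)$ is the completion of the free graded Lie algebra $\mathbb{L}(V)$. For a differential $\partial$ on $\widehat{\mathbb L}(V)$, $\partial_1$ is its linear part. A Maurer-Cartan element is $a\in L_{-1}$ with $\partial a+\frac12[a,a]=0$; then $\partial_a=\partial+\mathrm{ad}_a$ is again a differential. $\widehat{\mathbb{L}}(\Delta^n)$ denotes the free complete graded Lie algebra on generators $a_{i_0\dots i_p}$ of degree $p-1$, one for each $0\le i_0<\dots<i_p\le n$, $0\le p\le n$. Let $d a_{i_0\dots i_p}=\sum_{j=0}^p(-1)^ja_{i_0\dots\widehat{i_j}\dots i_p}$ ($da_i=0$), and let $\delta_i\colon\widehat{\mathbb{L}}(\Delta^{n-1})\to\widehat{\mathbb{L}}(\Delta^n)$, $0\le i\le n$, be the Lie morphism $\delta_i(a_{j_0\dots j_p})=a_{\ell_0\dots\ell_p}$, with $\ell_k=j_k$ if $j_k<i$ and $\ell_k=j_k+1$ if $j_k\ge i$. A sequence of compatible models of $\mathbf\Delta$ is a family of DGL's $\{(\widehat{\mathbb{L}}(\Delta^n),\partial)\}_{n\ge0}$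 such that: (1) each $a_i$ is a Maurer-Cartan element; (2) $\partial_1=d$; (3) each $\delta_i$ is a DGL morphism. Such a sequence is inductive if, for every $n\ge2$, $\partial_{a_0}a_{0\dots n}\in\widehat{\mathbb{L}}(\dot\Delta^n)$, where $\dot\Delta^n$ is the boundary of $\Delta^n$ and $\widehat{\mathbb{L}}(\dot\Delta^n)\subset\widehat{\mathbb{L}}(\Delta^n)$ is the free complete Lie algebra on all generators except $a_{0\dots n}$. *)

(* Defs.v *)
From HB Require Import structures.
From mathcomp Require Import all_boot all_order all_algebra.
From mathcomp Require Import boolp functions.
From mathcomp Require Import ring.

Set Implicit Arguments.
Unset Strict Implicit.
Unset Printing Implicit Defensive.

Import Order.TTheory GRing.Theory Num.Theory.

Local Open Scope ring_scope.

Definition ksign (i : int) : rat := (-1) ^ i.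

Inductive span (V : lmodType rat) (S : V -> Prop) : V -> Prop :=
| span_zero : span S 0
| span_add (a : rat) (x y : V) : S x -> span S y -> span S (a *: x + y).

(* The grading is internal: the carrier is the direct sum of the subspaces
   [homog k], so that no transport between degrees is ever needed. *)
Record graded_lie := GradedLie {
  glie_car :> lmodType rat;
  homog : int -> glie_car -> Prop;
  br : glie_car -> glie_car -> glie_car;
  homog_zero : forall k, homog k 0;
  homog_lin : forall k (a : rat) x y,
    homog k x -> homog k y -> homog k (a *: x + y);
  homog_span : forall x, span (fun y => exists k, homog k y) x;
  homog_indep : forall (s : seq int) (c : int -> glie_car), uniq s ->
    (forall k, homog k (c k)) -> \sum_(k <- s) c k = 0 ->
    forall k, k \in s -> c k = 0;
  br_linl : forall (a : rat) x y z, br (a *: x + y) z = a *: br x z + br y z;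
  br_linr : forall (a : rat) x y z, br z (a *: x + y) = a *: br z x + br z y;
  br_homog : forall i j x y, homog i x -> homog j y -> homog (i + j) (br x y);
  br_antisym : forall i j x y, homog i x -> homog j y ->
    br x y = - (ksign (i * j) *: br y x);
  br_jacobi : forall i j k x y z, homog i x -> homog j y -> homog k z ->
    br x (br y z) = br (br x y) z + ksign (i * j) *: br y (br x z)
}.

(* [lcs L m] is the term usually written L^(m+1): L^1 = L, L^n = [L, L^(n-1)]. *)
Fixpoint lcs (L : graded_lie) (m : nat) : L -> Prop :=
  if m is m'.+1 then
    span (fun z => exists x y : L, lcs m' y /\ z = br x y)
  else fun _ => True.

(* L is the limit of the L / L^m in graded vector spaces, i.e. in each degree:
   [x] is a compatible family of representatives, [y] its unique preimage. *)
Definition complete (L : graded_lie) : Prop :=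
  forall (k : int) (x : nat -> L),
    (forall m, homog k (x m)) ->
    (forall m, lcs m (x m.+1 - x m)) ->
    exists! y : L, homog k y /\ forall m, lcs m (y - x m).

Definition is_differential (L : graded_lie) (D : L -> L) : Prop :=
  [/\ linear D,
      forall k x, homog k x -> homog (k - 1) (D x),
      forall k x y, homog k x ->
        D (br x y) = br (D x) y + ksign k *: br x (D y)
    & forall x, D (D x) = 0].

Definition is_cdgl (L : graded_lie) (D : L -> L) : Prop :=
  complete L /\ is_differential D.

Definition dgl_morphism (L M : graded_lie) (D : L -> L) (E : M -> M)
    (f : L -> M) : Prop :=
  [/\ linear f,
      forall k x, homog k x -> homog k (f x),
      forall x y, f (br x y) = br (f x) (f y)
    & forall x, f (D x) = E (f x)].

Definition maurer_cartan (L : graded_lie) (D : L -> L) (a : L) : Prop :=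
  homog (-1) a /\ D a + 2^-1 *: br a a = 0.

Definition twist (L : graded_lie) (D : L -> L) (a : L) : L -> L :=
  fun x => D x + br a x.

Section SpanTheory.
Variable V : lmodType rat.
Implicit Types S : V -> Prop.

Lemma span_incl S x : S x -> span S x.
Proof.
by move=> Sx; rewrite -[x]addr0 -[x]scale1r; apply: span_add => //; exact: span_zero.
Qed.

Lemma spanD S x y : span S x -> span S y -> span S (x + y).
Proof.
elim=> [|a u v Su _ IH] Sy; first by rewrite add0r.
by rewrite -addrA; apply: span_add => //; exact: IH.
Qed.

Lemma spanZ S (a : rat) x : span S x -> span S (a *: x).
Proof.
elim=> [|b u v Su _ IH]; first by rewrite scaler0; exact: span_zero.
by rewrite scalerDr scalerA; apply: span_add.
Qed.

Lemma span_trans S (T : V -> Prop) x :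
  (forall y, S y -> span T y) -> span S x -> span T x.
Proof.
move=> ST; elim=> [|a u v Su _ IH]; first exact: span_zero.
by apply: spanD => //; apply: spanZ; exact: ST.
Qed.
End SpanTheory.

(* Noncommutative formal series, as functions giving the coefficient of each
   word: the tensor algebra on X completed by word length. *)
Definition series (X : finType) : Type := seq X -> rat.

HB.instance Definition _ (X : finType) :=
  GRing.Zmodule.copy (series X) (seq X -> rat).

Section SeriesLmodule.
Variable X : finType.
Implicit Types f g : series X.

Definition sscale (a : rat) f : series X := fun w => a * f w.

Fact sscaleA a b f : sscale a (sscale b f) = sscale (a * b) f.
Proof. by apply/funext => w; rewrite /sscale mulrA. Qed.

Fact sscale1 : left_id 1 sscale.
Proof. by move=> f; apply/funext => w; rewrite /sscale mul1r. Qed.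

Fact sscaleDr : right_distributive sscale +%R.
Proof. by move=> a f g; apply/funext => w; exact: mulrDr. Qed.

Fact sscaleDl f : {morph sscale^~ f : a b / a + b}.
Proof. by move=> a b; apply/funext => w; exact: mulrDl. Qed.

HB.instance Definition _ := GRing.Zmodule_isLmodule.Build rat (series X)
  sscaleA sscale1 sscaleDr sscaleDl.
End SeriesLmodule.

Section Series.
Variable X : finType.
Implicit Types f g h : series X.

Definition letter (x : X) : series X := fun w => (w == [:: x])%:R.

Definition smul f g : series X :=
  fun w => \sum_(i < (size w).+1) f (take i w) * g (drop i w).

Definition sder (x : X) f : series X := fun w => f (x :: w).

Lemma serieslin (a : rat) f g w : (a *: f + g) w = a * f w + g w.
Proof. by []. Qed.

Lemma smul_nil f g : smul f g [::] = f [::] * g [::].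
Proof. by rewrite /smul big_ord_recl big_ord0 addr0. Qed.

Lemma smul_cons f g x w :
  smul f g (x :: w) = f [::] * g (x :: w) + smul (sder x f) g w.
Proof. by rewrite /smul big_ord_recl. Qed.

Lemma smul_linl (a : rat) f g h :
  smul (a *: f + g) h = a *: smul f h + smul g h.
Proof.
apply/funext => w; rewrite serieslin /smul big_distrr -big_split /=.
by apply: eq_bigr => i _; rewrite serieslin; ring.
Qed.

Lemma smul_linr (a : rat) f g h :
  smul h (a *: f + g) = a *: smul h f + smul h g.
Proof.
apply/funext => w; rewrite serieslin /smul big_distrr -big_split /=.
by apply: eq_bigr => i _; rewrite serieslin; ring.
Qed.

Lemma sder_smul f g x : sder x (smul f g) = f [::] *: sder x g + smul (sder x f) g.
Proof. by apply/funext => w; rewrite serieslin /sder smul_cons. Qed.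

Lemma smulA f g h : smul f (smul g h) = smul (smul f g) h.
Proof.
apply/funext => w; elim: w f g h => [|x w IH] f g h.
  by rewrite !smul_nil mulrA.
by rewrite !smul_cons IH sder_smul smul_linl serieslin smul_nil; ring.
Qed.

Variable dg : X -> int.

Definition wdeg (w : seq X) : int := \sum_(x <- w) dg x.

Definition shomog (k : int) f : Prop := forall w, f w != 0 -> wdeg w = k.

(* The graded commutator f g - (-1)^(|f||g|) g f, extended bilinearly to
   inhomogeneous series (see [sbrE]). *)
Definition sbr f g : series X := fun w =>
  \sum_(i < (size w).+1)
    (f (take i w) * g (drop i w)
     - ksign (wdeg (take i w) * wdeg (drop i w))
       * (g (take i w) * f (drop i w))).

(* The degree k part of the free graded Lie algebra on X. The ground field has
   characteristic 0, so the free graded Lie algebra is the graded Lie subalgebra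
   of the tensor algebra generated by the letters. *)
Inductive lie_poly : int -> series X -> Prop :=
| lie_letter x : lie_poly (dg x) (letter x)
| lie_zero k : lie_poly k 0
| lie_lin k (a : rat) f g :
    lie_poly k f -> lie_poly k g -> lie_poly k (a *: f + g)
| lie_br i j f g :
    lie_poly i f -> lie_poly j g -> lie_poly (i + j) (sbr f g).

(* The degree k part of the completion by word length: a compatible family of
   classes modulo words of length > N is a series whose truncations are all
   truncations of Lie polynomials of degree k. *)
Definition lie_series (k : int) f : Prop :=
  forall N : nat, exists p, lie_poly k p /\
    forall w, (size w <= N)%N -> f w = p w.

(* The carrier of the completed free Lie algebra: the direct sum over all
   degrees. *)
Definition hat_lie : pred (series X) :=
  fun f => `[< span (fun g => exists k, lie_series k g) f >].

Lemma hat_lieP f : reflect (span (fun g => exists k, lie_series k g) f) (f \in hat_lie).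
Proof. exact: asboolP. Qed.

Lemma sbr_linl (a : rat) f g h : sbr (a *: f + g) h = a *: sbr f h + sbr g h.
Proof.
apply/funext => w; rewrite serieslin /sbr big_distrr -big_split /=.
by apply: eq_bigr => i _; rewrite !serieslin; ring.
Qed.

Lemma sbr_linr (a : rat) f g h : sbr h (a *: f + g) = a *: sbr h f + sbr h g.
Proof.
apply/funext => w; rewrite serieslin /sbr big_distrr -big_split /=.
by apply: eq_bigr => i _; rewrite !serieslin; ring.
Qed.

Lemma wdeg_cat u v : wdeg (u ++ v) = wdeg u + wdeg v.
Proof. exact: big_cat. Qed.

Lemma shomog0 k : shomog k 0.
Proof. by move=> w; rewrite eqxx. Qed.

Lemma shomog_lin k (a : rat) f g :
  shomog k f -> shomog k g -> shomog k (a *: f + g).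
Proof.
move=> fk gk w; rewrite serieslin.
have [->|/fk //] := eqVneq (f w) 0.
by rewrite mulr0 add0r => /gk.
Qed.

Lemma shomog_smul i j f g : shomog i f -> shomog j g -> shomog (i + j) (smul f g).
Proof.
move=> fi gj w fgw; have [l _ nz] : exists2 l : 'I_(size w).+1,
    true & f (take l w) * g (drop l w) != 0.
  apply: contrapT => H; move/eqP: fgw; apply; rewrite /smul big1 // => l _.
  by apply/eqP/negPn/negP => nz; apply: H; exists l.
move: nz; rewrite mulf_eq0 negb_or => /andP[/fi <- /gj <-].
by rewrite -wdeg_cat cat_take_drop.
Qed.

Lemma sbrE i j f g : shomog i f -> shomog j g ->
  sbr f g = smul f g - ksign (i * j) *: smul g f.
Proof.
move=> fi gj; apply/funext => w.
have -> : (smul f g - ksign (i * j) *: smul g f) w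
        = smul f g w - ksign (i * j) * smul g f w by [].
rewrite /sbr /smul big_distrr -sumrB /=; apply: eq_bigr => l _; congr (_ - _).
have [->|gn] := eqVneq (g (take l w)) 0; first by rewrite !mul0r !mulr0.
have [->|fn] := eqVneq (f (drop l w)) 0; first by rewrite !mulr0.
by rewrite (gj _ gn) (fi _ fn) [j * i]mulrC.
Qed.

Lemma shomog_sbr i j f g : shomog i f -> shomog j g -> shomog (i + j) (sbr f g).
Proof.
move=> fi gj; rewrite (sbrE fi gj).
have -> : smul f g - ksign (i * j) *: smul g f
        = (- ksign (i * j)) *: smul g f + smul f g by rewrite scaleNr addrC.
apply: shomog_lin; last exact: shomog_smul.
by have := shomog_smul gj fi; rewrite [j + i]addrC.
Qed.

Lemma lie_poly_homog k f : lie_poly k f -> shomog k f.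
Proof.
elim=> {k f} [x|k|k a f g _ fk _ gk|i j f g _ fi _ gj].
- move=> w; rewrite /letter; case: (w =P [:: x]) => [-> _|_]; last by rewrite eqxx.
  by rewrite /wdeg big_seq1.
- exact: shomog0.
- exact: shomog_lin.
- exact: shomog_sbr.
Qed.

Lemma lie_series_homog k f : lie_series k f -> shomog k f.
Proof.
move=> fk w; have [p [/lie_poly_homog pk ->//]] := fk (size w); exact: pk.
Qed.

Lemma lie_poly_series k f : lie_poly k f -> lie_series k f.
Proof. by move=> fk N; exists f. Qed.

Lemma lie_series_lin k (a : rat) f g :
  lie_series k f -> lie_series k g -> lie_series k (a *: f + g).
Proof.
move=> fk gk N; have [[p [pk fp]] [q [qk gq]]] := (fk N, gk N).
exists (a *: p + q); split; first exact: lie_lin.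
by move=> w wN; rewrite !serieslin fp ?gq.
Qed.

Lemma lie_series_br i j f g :
  lie_series i f -> lie_series j g -> lie_series (i + j) (sbr f g).
Proof.
move=> fk gk N; have [[p [pk fp]] [q [qk gq]]] := (fk N, gk N).
exists (sbr p q); split; first exact: lie_br.
move=> w wN; apply: eq_bigr => l _.
have tN : (size (take l w) <= N)%N by rewrite (leq_trans _ wN) ?size_take_min ?geq_minr.
have dN : (size (drop l w) <= N)%N by rewrite (leq_trans _ wN) ?size_drop ?leq_subr.
by rewrite !fp ?gq.
Qed.

Lemma hat_lie_submod : subsemimod_closed hat_lie.
Proof.
split; first split.
- by apply/hat_lieP; exact: span_zero.
- by move=> f g /hat_lieP fL /hat_lieP gL; apply/hat_lieP; exact: spanD.
- by move=> a f /hat_lieP fL; apply/hat_lieP; exact: spanZ.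
Qed.

HB.instance Definition _ :=
  GRing.isSubSemiModClosed.Build rat (series X) hat_lie hat_lie_submod.

Lemma sbr_hat f g : f \in hat_lie -> g \in hat_lie -> sbr f g \in hat_lie.
Proof.
move=> /hat_lieP fL /hat_lieP gL; apply/hat_lieP.
have br0 h : sbr 0 h = 0.
  by rewrite -[0 in LHS](scaler0 _ (-1 : rat)) -[X in sbr X]addr0 sbr_linl scaleN1r addNr.
have br0r h : sbr h 0 = 0.
  by rewrite -[0 in LHS](scaler0 _ (-1 : rat)) -[X in sbr _ X]addr0 sbr_linr scaleN1r addNr.
elim: fL => [|a f1 f2 [i f1i] _ IH]; first by rewrite br0; exact: span_zero.
rewrite sbr_linl; apply: spanD IH; apply: spanZ.
elim: gL => [|b g1 g2 [j g1j] _ IH]; first by rewrite br0r; exact: span_zero.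
rewrite sbr_linr; apply: spanD IH; apply/spanZ/span_incl.
by exists (i + j); exact: lie_series_br.
Qed.

Lemma ksign_sqr i : ksign i * ksign i = 1.
Proof. by rewrite /ksign -expfzMl mulrNN mulr1 exp1rz. Qed.

Lemma ksignD i j : ksign (i + j) = ksign i * ksign j.
Proof. by rewrite /ksign expfzDr. Qed.

Lemma sbr_antisym i j f g : shomog i f -> shomog j g ->
  sbr f g = - (ksign (i * j) *: sbr g f).
Proof.
move=> fi gj; rewrite (sbrE fi gj) (sbrE gj fi) [j * i]mulrC scalerBr scalerA.
by rewrite ksign_sqr scale1r opprB.
Qed.

Lemma sbr_jacobi i j k f g h : shomog i f -> shomog j g -> shomog k h ->
  sbr f (sbr g h) = sbr (sbr f g) h + ksign (i * j) *: sbr g (sbr f h).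
Proof.
move=> fi gj hk.
rewrite (sbrE fi (shomog_sbr gj hk)) (sbrE (shomog_sbr fi gj) hk).
rewrite (sbrE gj (shomog_sbr fi hk)) (sbrE fi gj) (sbrE gj hk) (sbrE fi hk).
rewrite !mulrDr !mulrDl !ksignD [j * i]mulrC.
have Bl c (u v z : series X) : smul (u - c *: v) z = smul u z - c *: smul v z.
  by rewrite addrC -scaleNr smul_linl addrC scaleNr.
have Br c (u v z : series X) : smul z (u - c *: v) = smul z u - c *: smul z v.
  by rewrite addrC -scaleNr smul_linr addrC scaleNr.
rewrite !Bl !Br !smulA; apply/funext => w.
have s1 := ksign_sqr (i * j).
set A := ksign (i * j) in s1 *; set B := ksign (i * k); set C := ksign (j * k).
have subE (u v : series X) : (u - v) w = u w - v w by [].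
have addE (u v : series X) : (u + v) w = u w + v w by [].
have scaleE (c : rat) (u : series X) : (c *: u) w = c * u w by [].
rewrite !(subE, addE, scaleE).
ring: s1.
Qed.


End Series.

Section FreeCompleteLie.
Variables (X : finType) (dg : X -> int).

Record hat_car := HatCar { ser :> series X; serP : ser \in hat_lie dg }.

HB.instance Definition _ := [isSub for ser].
HB.instance Definition _ := [Choice of hat_car by <:].
HB.instance Definition _ := [SubChoice_isSubLmodule of hat_car by <:].

Implicit Types x y z : hat_car.

Definition hat_homog (k : int) x : Prop := lie_series dg k (ser x).

Definition hat_br x y : hat_car := HatCar (sbr_hat (serP x) (serP y)).

Fact hat_homog_zero k : hat_homog k 0.
Proof. exact/lie_poly_series/lie_zero. Qed.

Fact hat_homog_lin k (a : rat) x y :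
  hat_homog k x -> hat_homog k y -> hat_homog k (a *: x + y).
Proof. exact: lie_series_lin. Qed.

Fact hat_homog_span x : span (fun y => exists k, hat_homog k y) x.
Proof.
suff H f : span (fun g => exists k, lie_series dg k g) f ->
    forall y, ser y = f -> span (fun y => exists k, hat_homog k y) y.
  exact: H (elimT (hat_lieP _ _) (serP x)) x (erefl _).
elim=> {f} [|a g h [k gk] hL IH] y yE.
  have -> : y = 0 by apply/val_inj/yE.
  exact: span_zero.
have gP : g \in hat_lie dg by apply/hat_lieP/span_incl; exists k.
have hP : h \in hat_lie dg by apply/hat_lieP.
have -> : y = a *: HatCar gP + HatCar hP by apply/val_inj/yE.
by apply: span_add; [exists k | exact: IH].
Qed.

Fact ser_sum (s : seq int) (c : int -> hat_car) w :
  ser (\sum_(k <- s) c k) w = \sum_(k <- s) ser (c k) w.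
Proof.
elim: s => [|k s IH]; first by rewrite !big_nil.
by rewrite !big_cons -IH.
Qed.

Fact hat_homog_indep (s : seq int) (c : int -> hat_car) : uniq s ->
  (forall k, hat_homog k (c k)) -> \sum_(k <- s) c k = 0 ->
  forall k, k \in s -> c k = 0.
Proof.
move=> us cP s0 k ks; apply/val_inj/funext => w /=.
have [//|nz] := eqVneq (ser (c k) w) 0; have wk := lie_series_homog (cP k) nz.
rewrite -[RHS]/(ser (0 : hat_car) w) -s0 ser_sum (bigD1_seq k) //= big1_seq ?addr0 //.
move=> j /andP[jk _]; apply/eqP/negPn/negP => /(lie_series_homog (cP j)) wj.
by move/eqP: jk; apply; rewrite -wk -wj.
Qed.

Fact hat_br_linl (a : rat) x y z :
  hat_br (a *: x + y) z = a *: hat_br x z + hat_br y z.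
Proof. by apply: val_inj; exact: sbr_linl. Qed.

Fact hat_br_linr (a : rat) x y z :
  hat_br z (a *: x + y) = a *: hat_br z x + hat_br z y.
Proof. by apply: val_inj; exact: sbr_linr. Qed.

Fact hat_br_homog i j x y :
  hat_homog i x -> hat_homog j y -> hat_homog (i + j) (hat_br x y).
Proof. exact: lie_series_br. Qed.

Fact hat_br_antisym i j x y : hat_homog i x -> hat_homog j y ->
  hat_br x y = - (ksign (i * j) *: hat_br y x).
Proof.
move=> /lie_series_homog xi /lie_series_homog yj.
by apply: val_inj; exact: sbr_antisym.
Qed.

Fact hat_br_jacobi i j k x y z :
  hat_homog i x -> hat_homog j y -> hat_homog k z ->
  hat_br x (hat_br y z)
  = hat_br (hat_br x y) z + ksign (i * j) *: hat_br y (hat_br x z).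
Proof.
move=> /lie_series_homog xi /lie_series_homog yj /lie_series_homog zk.
by apply: val_inj; exact: (sbr_jacobi xi yj zk).
Qed.

Definition hatL : graded_lie := GradedLie hat_homog_zero hat_homog_lin
  hat_homog_span hat_homog_indep hat_br_linl hat_br_linr hat_br_homog
  hat_br_antisym hat_br_jacobi.

Fact letter_hat (x : X) : letter x \in hat_lie dg.
Proof.
by apply/hat_lieP/span_incl; exists (dg x); exact/lie_poly_series/lie_letter.
Qed.

Definition gen (x : X) : hatL := HatCar (letter_hat x).

(* The component of word length 1. *)
Definition linear_part (f : hatL) : hatL :=
  \sum_(x : X) ser f [:: x] *: gen x.

End FreeCompleteLie.

Section Pushforward.
Variables (X Y : finType) (phi : X -> Y).
Implicit Types f g : series X.

(* The continuous algebra morphism between completed tensor algebras that maps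
   each letter x to the letter phi x. *)
Definition push f : series Y :=
  fun w => \sum_(u : (size w).-tuple X | map phi u == w) f u.

Lemma push_nil f : push f [::] = f [::].
Proof.
rewrite /push (eq_bigl predT) => [|u]; last by rewrite tuple0.
by rewrite (big_pred1 [tuple]) // => u; rewrite tuple0.
Qed.

Lemma push_cons f y w :
  push f (y :: w) = \sum_(x | phi x == y) push (sder x f) w.
Proof.
rewrite /push pair_big_dep /=.
rewrite (reindex (fun p : X * (size w).-tuple X => [tuple of p.1 :: p.2])) /=.
  by apply: eq_big => [[x u]|[x u] _] //=.
exists (fun u : (size w).+1.-tuple X => (thead u, [tuple of behead u])).
  by move=> [x u] _ /=; congr pair; apply: val_inj.
by move=> u _; apply: val_inj => /=; case/tupleP: u.
Qed.

Lemma push_lin (a : rat) f g : push (a *: f + g) = a *: push f + push g.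
Proof.
apply/funext => w; rewrite serieslin /push big_distrr -big_split /=.
by apply: eq_bigr.
Qed.

Lemma push0 : push 0 = 0.
Proof. by apply/funext => w; rewrite /push big1. Qed.

Lemma push_smul f g : push (smul f g) = smul (push f) (push g).
Proof.
apply/funext => w; elim: w f g => [|y w IH] f g.
  by rewrite push_nil !smul_nil !push_nil.
rewrite push_cons smul_cons push_nil push_cons mulr_sumr.
have -> : smul (sder y (push f)) (push g) w
        = \sum_(x | phi x == y) smul (push (sder x f)) (push g) w.
  rewrite /smul exchange_big /=; apply: eq_bigr => i _.
  by rewrite /sder push_cons mulr_suml.
rewrite -big_split /=; apply: eq_bigr => x _.
by rewrite sder_smul push_lin serieslin IH.
Qed.

Lemma push_letter x : push (letter x) = letter (phi x).
Proof.
apply/funext => -[|y w]; first by rewrite push_nil.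
rewrite push_cons.
have pE z : push (sder z (letter x)) w = ((z == x) && (w == [::]))%:R.
  case: w => [|y' w]; first by rewrite push_nil /sder /letter eqseq_cons.
  by rewrite andbF push_cons big1 // => t _; rewrite /push big1 // => u _;
     rewrite /sder /letter eqseq_cons andbF.
rewrite (eq_bigr _ (fun z _ => pE z)) /letter eqseq_cons.
have [<-|ne] := eqVneq (phi x) y.
  by rewrite (bigD1 x) //= eqxx /= big1 ?addr0 ?eqxx // => z /andP[_ /negPf ->].
rewrite andFb big1 // => z /eqP zy.
by have [zx|//] := eqVneq z x; move/eqP: ne; case; rewrite -zx.
Qed.

Variables (dX : X -> int) (dY : Y -> int).
Hypothesis phi_deg : forall x, dY (phi x) = dX x.

Lemma push_shomog k f : shomog dX k f -> shomog dY k (push f).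
Proof.
move=> fk w; apply: contraNeq => wk; apply/eqP; rewrite /push big1 // => u /eqP uw.
apply/eqP/negPn/negP => /fk uk; move/eqP: wk; apply.
by rewrite -uk /wdeg -[in LHS]uw big_map; apply: eq_bigr => x _.
Qed.

Lemma push_sbr i j f g : shomog dX i f -> shomog dX j g ->
  push (sbr dX f g) = sbr dY (push f) (push g).
Proof.
move=> fi gj; rewrite (sbrE fi gj) (sbrE (push_shomog fi) (push_shomog gj)).
have -> : smul f g - ksign (i * j) *: smul g f
        = (- ksign (i * j)) *: smul g f + smul f g by rewrite scaleNr addrC.
by rewrite push_lin !push_smul scaleNr addrC.
Qed.

Lemma push_lie_poly k f : lie_poly dX k f -> lie_poly dY k (push f).
Proof.
elim=> {k f} [x|k|k a f g _ IHf _ IHg|i j f g fi IHf gj IHg].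
- by rewrite push_letter -phi_deg; exact: lie_letter.
- by rewrite push0; exact: lie_zero.
- by rewrite push_lin; exact: lie_lin.
- rewrite (push_sbr (lie_poly_homog fi) (lie_poly_homog gj)); exact: lie_br.
Qed.

Lemma push_lie_series k f : lie_series dX k f -> lie_series dY k (push f).
Proof.
move=> fk N; have [p [pk fp]] := fk N.
exists (push p); split; first exact: push_lie_poly.
by move=> w wN; apply: eq_bigr => u _; rewrite fp // size_tuple.
Qed.

Lemma push_hat f : f \in hat_lie dX -> push f \in hat_lie dY.
Proof.
move=> /hat_lieP fL; apply/hat_lieP.
elim: fL => [|a f1 f2 [k f1k] _ IH]; first by rewrite push0; exact: span_zero.
by rewrite push_lin; apply: span_add IH; exists k; exact: push_lie_series.
Qed.

(* The morphism of free complete graded Lie algebras induced by phi. *)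
Definition hat_map (f : hatL dX) : hatL dY := HatCar (push_hat (serP f)).

Lemma hat_map_gen x : hat_map (gen dX x) = gen dY (phi x).
Proof. by apply: val_inj; exact: push_letter. Qed.

End Pushforward.

(* The generator a_{i_0 ... i_p} is indexed by the nonempty set {i_0, ..., i_p}
   of vertices of the n-simplex, which are the elements of 'I_n.+1. *)
Definition face (n : nat) : Type := {A : {set 'I_n.+1} | A != set0}.

(* p + 1 vertices give degree p - 1. *)
Definition face_deg (n : nat) (A : face n) : int := #|val A|%:Z - 2.

Fact vertex_proof n (i : 'I_n.+1) : [set i] != set0.
Proof. by apply/set0Pn; exists i; rewrite in_set1. Qed.

Definition vertex n (i : 'I_n.+1) : face n := exist _ [set i] (vertex_proof i).

Fact top_proof n : [set: 'I_n.+1] != set0.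
Proof. by apply/set0Pn; exists ord0; rewrite in_setT. Qed.

Definition top n : face n := exist _ [set: 'I_n.+1] (top_proof n).

Definition Lhat (n : nat) : graded_lie := hatL (@face_deg n).

Definition agen n (A : face n) : Lhat n := gen (@face_deg n) A.

(* The sign exponent is the position of the removed vertex i in A, and
   [insub (val A :\ i)] is [None] when A = {i}, which gives d a_i = 0. *)
Definition simplicial_d n (A : face n) : Lhat n :=
  \sum_(i in val A)
    (-1) ^+ #|[set j in val A | (j < i)%N]| *:
    (if insub (val A :\ i) is Some B then agen B else 0).

Fact coface_proof n (i : 'I_n.+2) (A : face n) : lift i @: val A != set0.
Proof.
by case: A => A /= /set0Pn[j jA]; apply/set0Pn; exists (lift i j); exact: imset_f.
Qed.

(* [lift i j] is j if j < i and j + 1 otherwise. *)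
Definition coface n (i : 'I_n.+2) (A : face n) : face n.+1 :=
  exist _ (lift i @: val A) (coface_proof i A).

Fact coface_deg n (i : 'I_n.+2) (A : face n) :
  face_deg (coface i A) = face_deg A.
Proof. by rewrite /face_deg /= card_imset //; exact: lift_inj. Qed.

Definition delta n (i : 'I_n.+2) : Lhat n -> Lhat n.+1 := hat_map (coface_deg i).

Definition bface (n : nat) : Type := {A : face n | A != top n}.

Definition bface_deg n (A : bface n) : int := face_deg (val A).

Definition Lhat_boundary (n : nat) : graded_lie := hatL (@bface_deg n).

Definition boundary_incl n : Lhat_boundary n -> Lhat n :=
  hat_map (phi := val) (fun A : bface n => erefl (bface_deg A)).

Definition compatible_models (D : forall n, Lhat n -> Lhat n) : Prop :=
  [/\ forall n, is_cdgl (D n),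
      forall n (i : 'I_n.+1), maurer_cartan (D n) (agen (vertex i)),
      forall n (A : face n), linear_part (D n (agen A)) = simplicial_d A
    & forall n (i : 'I_n.+2), dgl_morphism (D n) (D n.+1) (@delta n i)].

(* L(boundary) sits in L(Delta^n) as the image of [boundary_incl]. *)
Definition inductive_models (D : forall n, Lhat n -> Lhat n) : Prop :=
  forall n, (2 <= n)%N ->
    exists y : Lhat_boundary n,
      twist (D n) (agen (vertex ord0)) (agen (top n)) = boundary_incl y.

(* Main.v *)
Require Import Defs.
From mathcomp Require Import all_boot all_order all_algebra.
From HB Require Import structures.
From mathcomp Require Import boolp ring zify lra.

Set Implicit Arguments.
Unset Strict Implicit.
Unset Printing Implicit Defensive.

Import Order.TTheory GRing.Theory Num.Theory.
Local Open Scope ring_scope.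

(** The differential of such a sequence is determined by the values
    t_n = D a_(0 ... n): compatibility with the cofaces forces D a_A to be the image
    of t_p, p = |A| - 1, under the increasing enumeration of the vertices of A, and
    conversely any family t gives, on every simplex, one continuous derivation of
    degree -1, and these derivations commute with the cofaces. Since derivations are
    determined on letters, D D = 0 on all simplices as soon as D t_n = 0 for all n.
    So everything comes down to choosing t_n by induction on n
    ([coherent_family]).

    For n > 0 write t_n = u - [a_0, a_(0 ... n)] and let Delta = D + ad a_0, so that
    Delta a_(0 ... n) = u. The condition on t_n becomes Delta u = 0; moreover u must
    be a Lie series of degree n - 2 with linear part d a_(0 ... n) and, to get an
    inductive model when n > 1, it must not involve the letter a_(0 ... n). Such a u
    is found by successive corrections in increasing word length
    ([obstruction_theory]): if Delta u starts in length l, its leading term f is a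
    cycle for the linear differential d, and u is corrected by some v of length l
    with d v = f.

    In the whole free Lie algebra f need not be a boundary: the homology of d there
    is generated by a_0 and w = d a_(0 ... n), and brackets such as [a_0, w] are in
    the way. They are avoided by staying in the subalgebra generated by the
    differences a_i - a_0 and by the letters of positive dimension. Inside the
    algebra of series it is cut out by a linear condition at each position of the
    words, here called translation invariance ([invariant]), and Delta preserves it:
    on vertices because Delta (a_i - a_0) = - (a_i - a_0)^2, on other faces by the
    choice of the previous t_p. In this subalgebra the homology of d
    is generated by w alone if n > 1, and vanishes if n = 1. As w has degree n - 2,
    no bracket of at least two copies of w has the degree n - 3 of f, so f is a
    boundary.

    That last step is made explicit by a contraction ([contraction]). Coning with
    apex 0 extends to a derivation S, and E = dS + Sd is a derivation again. For
    n > 1 the cone over the face F = {1, ..., n} is the forbidden letter a_(0 ... n),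
    and S kills a_F. On translation-invariant series, words containing a_0 may be
    ignored; on the others E multiplies a word by its number of letters different
    from a_F, up to words with more letters a_F. Induction on the number of
    letters a_F inverts E on cycles of the right degree.

    Completeness of the free complete Lie algebra ([hatL_complete]) holds because a
    Lie series f without linear part is a finite sum of brackets [x, g_x] over the
    letters x, with g_x of order one less: the lower central series is the filtration
    by word length. *)

(** * Formal series *)
Lemma ksign0 : ksign 0 = 1. Proof. by []. Qed.

Lemma ksignN i : ksign (- i) = ksign i.
Proof. by rewrite -[LHS]mulr1 -(ksign_sqr i) mulrA -ksignD addNr mul1r. Qed.

Section SeriesCalculus.
Variable X : finType.
Implicit Types (f g h : series X) (w : seq X).

Lemma seriesD f g w : (f + g) w = f w + g w. Proof. by []. Qed.
Lemma seriesN f w : (- f) w = - f w. Proof. by []. Qed.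
Lemma seriesB f g w : (f - g) w = f w - g w. Proof. by []. Qed.
Lemma seriesZ a f w : (a *: f) w = a * f w. Proof. by []. Qed.
Lemma series0 w : (0 : series X) w = 0. Proof. by []. Qed.

Lemma series_sum (I : Type) (r : seq I) (P : pred I) (F : I -> series X) w :
  (\sum_(i <- r | P i) F i) w = \sum_(i <- r | P i) F i w.
Proof. by apply: (big_morph (fun f : series X => f w)). Qed.

Definition seriesE := (seriesD, seriesN, seriesZ, series0, series_sum).

Definition smulr g f := smul f g.

HB.instance Definition _ f := GRing.isLinear.Build rat (series X) (series X)
  *:%R (smul f) (fun a g h => smul_linr a g h f).
HB.instance Definition _ g := GRing.isLinear.Build rat (series X) (series X)
  *:%R (smulr g) (fun a f h => smul_linl a f h g).

Lemma smulBl f g h : smul (f - g) h = smul f h - smul g h.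
Proof. exact: (linearB (smulr h)). Qed.
Lemma smulDl f g h : smul (f + g) h = smul f h + smul g h.
Proof. exact: (linearD (smulr h)). Qed.
Lemma smulNl f h : smul (- f) h = - smul f h.
Proof. exact: (linearN (smulr h)). Qed.
Lemma smulZl a f h : smul (a *: f) h = a *: smul f h.
Proof. exact: (linearZ_LR (smulr h)). Qed.
Lemma smul0l h : smul 0 h = 0.
Proof. exact: (linear0 (smulr h)). Qed.
Lemma smul_suml (I : Type) (r : seq I) (P : pred I) (F : I -> series X) g :
  smul (\sum_(i <- r | P i) F i) g = \sum_(i <- r | P i) smul (F i) g.
Proof. exact: (linear_sum (smulr g)). Qed.

Lemma smulDr f g h : smul h (f + g) = smul h f + smul h g.
Proof. exact: linearD. Qed.
Lemma smulBr f g h : smul h (f - g) = smul h f - smul h g.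
Proof. exact: linearB. Qed.
Lemma smulNr f h : smul h (- f) = - smul h f.
Proof. exact: linearN. Qed.
Lemma smulZr a f h : smul h (a *: f) = a *: smul h f.
Proof. exact: linearZ_LR. Qed.

Fact sder_lin x : linear (@sder X x). Proof. by []. Qed.
HB.instance Definition _ x := GRing.isLinear.Build rat (series X) (series X)
  *:%R (@sder X x) (sder_lin x).

Definition sone : series X := fun w => (w == [::])%:R.

Lemma smul1 f : smul f sone = f.
Proof.
apply/funext => w; elim: w f => [|x w IH] f; first by rewrite smul_nil mulr1.
by rewrite smul_cons IH mulr0 add0r.
Qed.

Lemma sder_letter x y : sder y (letter x) = (y == x)%:R *: sone.
Proof. by apply/funext => w; rewrite seriesZ /sder /letter eqseq_cons -mulnb natrM. Qed.

Lemma sder_one y : sder y sone = 0. Proof. exact/funext. Qed.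

Lemma smul_letter_nil x f : smul (letter x) f [::] = 0.
Proof. by rewrite smul_nil mul0r. Qed.

Lemma smul1l f : smul sone f = f.
Proof.
apply/funext => -[|x w]; rewrite ?smul_nil ?smul_cons ?sder_one ?smul0l ?series0 mul1r //.
by rewrite addr0.
Qed.

Lemma smul_letter_cons x y f w :
  smul (letter x) f (y :: w) = (y == x)%:R * f w.
Proof. by rewrite smul_cons mul0r add0r sder_letter smulZl seriesZ smul1l. Qed.

Lemma series_split f : f = f [::] *: sone + \sum_x smul (letter x) (sder x f).
Proof.
apply/funext => -[|y w].
  by rewrite !seriesE mulr1 big1 ?addr0 // => x _; rewrite smul_letter_nil.
rewrite !seriesE mulr0 add0r (bigD1 y) //= big1 => [|x /negPf xy].
  by rewrite smul_letter_cons eqxx mul1r addr0.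
by rewrite smul_letter_cons eq_sym xy mul0r.
Qed.

(** Identities between derivations are proved with this principle: the difference C
    of the two sides satisfies a recursion through the left quotients of its
    argument, hence vanishes by induction on words. *)
Lemma shift_recursion0 (I : Type) (C : I -> series X) (c : I -> X -> rat)
    (q : X -> I -> I) :
  (forall i, C i = \sum_y c i y *: smul (letter y) (C (q y i))) ->
  forall i, C i = 0.
Proof.
move=> CE i; apply/funext => w; elim: w i => [|z w IH] i.
  by rewrite CE series_sum big1 // => y _; rewrite seriesZ smul_letter_nil mulr0.
rewrite CE series_sum big1 // => y _.
by rewrite seriesZ smul_letter_cons IH !mulr0.
Qed.

Definition linf (c : X -> rat) : series X := \sum_x c x *: letter x.

Lemma linf_letter c x : linf c [:: x] = c x.
Proof.
rewrite /linf series_sum (bigD1 x) //= big1 => [|y /negPf yx].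
  by rewrite seriesZ /letter eqxx mulr1 addr0.
by rewrite seriesZ /letter eqseq_cons eq_sym yx mulr0.
Qed.

Lemma linf_size c w : size w != 1 -> linf c w = 0.
Proof.
move=> w1; rewrite /linf series_sum big1 // => x _; rewrite seriesZ /letter.
by case: (w =P [:: x]) w1 => [->|_ _]; rewrite // mulr0.
Qed.

Lemma smul_linf_nil c f : smul (linf c) f [::] = 0.
Proof. by rewrite smul_nil linf_size ?mul0r. Qed.

Lemma smul_linf_cons c f y w : smul (linf c) f (y :: w) = c y * f w.
Proof.
rewrite /linf smul_suml series_sum (bigD1 y) //= big1 => [|x /negPf xy].
  by rewrite smulZl seriesZ smul_letter_cons eqxx mul1r addr0.
by rewrite smulZl seriesZ smul_letter_cons eq_sym xy mul0r mulr0.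
Qed.

Lemma letter_linf x : letter x = linf (fun y => (y == x)%:R).
Proof.
rewrite /linf (bigD1 x) //= big1 => [|y /negPf ->]; last by rewrite scale0r.
by rewrite eqxx scale1r addr0.
Qed.

Definition ord_ge (a : nat) f := forall w, (size w < a)%N -> f w = 0.

Lemma ord_lin a c f g : ord_ge a f -> ord_ge a g -> ord_ge a (c *: f + g).
Proof. by move=> fa ga w wa; rewrite serieslin fa // ga // mulr0 addr0. Qed.

Lemma ordD a f g : ord_ge a f -> ord_ge a g -> ord_ge a (f + g).
Proof. by move=> fa ga w wa; rewrite seriesD fa // ga // addr0. Qed.

Lemma ordZ a c f : ord_ge a f -> ord_ge a (c *: f).
Proof. by move=> fa w wa; rewrite seriesZ fa // mulr0. Qed.

Lemma ordB a f g : ord_ge a f -> ord_ge a g -> ord_ge a (f - g).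
Proof. by move=> fa ga w wa; rewrite seriesB fa // ga // subr0. Qed.

Lemma ord_ge0 a : ord_ge a 0. Proof. by []. Qed.

Lemma ord_le a b f : (a <= b)%N -> ord_ge b f -> ord_ge a f.
Proof. by move=> ab fb w wa; apply: fb; exact: leq_trans wa ab. Qed.

Lemma ord_smul a b f g : ord_ge a f -> ord_ge b g -> ord_ge (a + b)%N (smul f g).
Proof.
move=> fa gb w wab; rewrite /smul big1 // => i _.
have [lt|ge] := ltnP (size (take i w)) a; first by rewrite fa // mul0r.
rewrite gb ?mulr0 //; move: ge; rewrite size_take_min size_drop; lia.
Qed.

Lemma ord_linf c : ord_ge 1 (linf c).
Proof. by case=> // _; rewrite linf_size. Qed.

Lemma ord2_sub_linf f : f [::] = 0 -> ord_ge 2 (f - linf (fun x => f [:: x])).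
Proof.
move=> f0 [|x [|//]] _; rewrite seriesB ?linf_letter ?subrr //.
by rewrite f0 linf_size ?subr0.
Qed.

Lemma ord_all0 f : (forall a, ord_ge a f) -> f = 0.
Proof. by move=> fa; apply/funext => w; apply: (fa (size w).+1). Qed.

Definition supported (P : pred X) f := forall w, ~~ all P w -> f w = 0.

Lemma supp_lin P c f g :
  supported P f -> supported P g -> supported P (c *: f + g).
Proof. by move=> fP gP w wP; rewrite serieslin fP // gP // mulr0 addr0. Qed.

Lemma supp0 P : supported P 0. Proof. by []. Qed.

Lemma supp_smul P f g : supported P f -> supported P g -> supported P (smul f g).
Proof.
move=> fP gP w; rewrite /smul => wP; apply: big1 => i _.
have [tP|/fP ->] := boolP (all P (take i w)); last by rewrite mul0r.
by rewrite [X in _ * X]gP ?mulr0 //; move: wP; rewrite -{1}(cat_take_drop i w) all_cat tP.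
Qed.

Lemma supp_sder (P : pred X) x f : supported P f -> supported P (sder x f).
Proof. by move=> fP w wP; apply: fP; rewrite /= negb_and wP orbT. Qed.

Lemma supp_sder0 (P : pred X) x f : supported P f -> ~~ P x -> sder x f = 0.
Proof. by move=> fP xP; apply/funext => w; apply: fP; rewrite /= negb_and xP. Qed.

Lemma supp_linf (P : pred X) c : (forall x, ~~ P x -> c x = 0) -> supported P (linf c).
Proof.
move=> cP [|x [|y w]] //; last by rewrite linf_size.
by rewrite /= andbT linf_letter => /cP.
Qed.

Variable vx : pred X.

(** If vx selects the vertices, this is the completed tensor algebra on the kernel of
    the functional that is 1 on vertices and 0 on the other letters: f vanishes when
    that functional is applied at any position of the words. The kernel is spanned by
    the differences of two vertices and by the other letters. *)
Definition invariant f := forall p s, \sum_(x | vx x) f (p ++ x :: s) = 0.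

Lemma inv_lin c f g : invariant f -> invariant g -> invariant (c *: f + g).
Proof.
move=> fi gi p s; rewrite (eq_bigr (fun x => c * f (p ++ x :: s) + g (p ++ x :: s))) //.
by rewrite big_split -big_distrr fi gi /= mulr0 addr0.
Qed.

Lemma inv0 : invariant 0. Proof. by move=> p s; rewrite big1. Qed.

Lemma invZ c f : invariant f -> invariant (c *: f).
Proof. by move=> fi; rewrite -[c *: f]addr0; apply: inv_lin inv0. Qed.

Lemma invD f g : invariant f -> invariant g -> invariant (f + g).
Proof. by rewrite -[X in invariant (X + _)]scale1r; exact: inv_lin. Qed.

Lemma invB f g : invariant f -> invariant g -> invariant (f - g).
Proof. by move=> fi gi; rewrite addrC -scaleN1r; exact: inv_lin. Qed.

Lemma inv_sum (I : Type) (r : seq I) (P : pred I) (F : I -> series X) :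
  (forall i, P i -> invariant (F i)) -> invariant (\sum_(i <- r | P i) F i).
Proof. by move=> Fi; elim/big_ind: _ => //; [exact: inv0 | exact: invD]. Qed.

Lemma inv_sder x f : invariant f -> invariant (sder x f).
Proof. by move=> fi p s; apply: (fi (x :: p)). Qed.

Lemma inv_sum_sder f : invariant f -> \sum_(x | vx x) sder x f = 0.
Proof. by move=> fi; apply/funext => w; rewrite series_sum; exact: (fi [::]). Qed.

Lemma inv_smul f g : invariant f -> invariant g -> invariant (smul f g).
Proof.
move=> + gi p s; elim: p f => [|y p IH] f fi /=.
  under eq_bigr do rewrite smul_cons.
  rewrite big_split -big_distrr /= (gi [::]) mulr0 add0r.
  rewrite -[LHS](series_sum _ _ (fun x => smul (sder x f) g)) -smul_suml.
  by rewrite inv_sum_sder // smul0l.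
under eq_bigr do rewrite smul_cons.
by rewrite big_split -big_distrr /= (gi (y :: p)) mulr0 add0r IH //; exact: inv_sder.
Qed.

Lemma inv_linf c : \sum_(x | vx x) c x = 0 -> invariant (linf c).
Proof.
move=> c0 [|y p] [|z s] /=.
- by under eq_bigr do rewrite linf_letter.
- by rewrite big1 // => x _; rewrite linf_size.
- by rewrite big1 // => x _; rewrite linf_size //= size_cat addnC.
- by rewrite big1 // => x _; rewrite linf_size //= size_cat addnC.
Qed.

(** A vertex can be traded for minus the sum of the others, until a0 no longer
    occurs. *)
Lemma inv_eq0 a0 f l : vx a0 -> invariant f ->
  (forall w, size w = l -> a0 \notin w -> f w = 0) ->
  forall w, size w = l -> f w = 0.
Proof.
move=> va fi f0 w; move: {2}(count_mem a0 w) (leqnn (count_mem a0 w)) => n.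
elim: n w => [|n IH] w wn wl.
  by apply: f0 => //; apply/count_memPn/eqP; rewrite -leqn0.
have [aw|] := boolP (a0 \in w); last exact: f0.
case/splitPr: aw wn wl => p s; rewrite count_cat /= eqxx => wn wl.
have := fi p s; rewrite (bigD1 a0) //= big1 ?addr0 // => x /andP[_ /negPf xa].
apply: IH; last by rewrite -wl !size_cat.
by rewrite count_cat /= xa; lia.
Qed.

End SeriesCalculus.
(** * Continuous derivations *)
Section Derivations.
Variables (X : finType) (dg : X -> int).
Implicit Types (f g h : series X) (w : seq X) (e : int) (eta : X -> series X).

(** The derivation of degree e that maps the letter x to eta x, by recursion on words
    (see [derE]): split off the first letter x and either apply eta to x, or keep x
    with the Koszul sign and differentiate the rest. *)
Fixpoint der_coef e eta f w : rat :=
  \sum_x smul (eta x) (sder x f) w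
  + (if w is y :: w' then ksign (e * dg y) * der_coef e eta (sder y f) w' else 0).

Definition der e eta f : series X := der_coef e eta f.

Arguments der : simpl never.

(** The sign automorphism that appears in the Leibniz rule [derM] for series that need
    not be homogeneous. *)
Definition sign_twist e f : series X := fun w => ksign (e * wdeg dg w) * f w.

Lemma derE e eta f : der e eta f = \sum_x (smul (eta x) (sder x f)
   + ksign (e * dg x) *: smul (letter x) (der e eta (sder x f))).
Proof.
apply/funext => -[|y w]; rewrite big_split /= seriesD !series_sum /der /=.
  by congr (_ + _); rewrite big1 // => x _; rewrite seriesZ smul_letter_nil mulr0.
congr (_ + _); rewrite (bigD1 y) //= big1 => [|x /negPf xy].
  by rewrite seriesZ smul_letter_cons eqxx mul1r addr0.
by rewrite seriesZ smul_letter_cons eq_sym xy mul0r mulr0.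
Qed.

Lemma der_lin e eta : linear (der e eta).
Proof.
move=> a f g; apply/funext => w; rewrite serieslin /der.
elim: w f g => [|y w IH] f g /=.
  rewrite !addr0 big_distrr -big_split /=; apply: eq_bigr => x _.
  by rewrite linearP serieslin.
rewrite linearP IH; set s1 := \sum_x _; set s2 := \sum_x _; set s3 := \sum_x _.
have -> : s1 = a * s2 + s3.
  rewrite /s1 /s2 /s3 big_distrr -big_split /=; apply: eq_bigr => x _.
  by rewrite !linearP serieslin.
ring.
Qed.

HB.instance Definition _ e eta := GRing.isLinear.Build rat (series X) (series X)
  *:%R (der e eta) (@der_lin e eta).

Lemma derD e eta f g : der e eta (f + g) = der e eta f + der e eta g.
Proof. exact: linearD. Qed.
Lemma derB e eta f g : der e eta (f - g) = der e eta f - der e eta g.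
Proof. exact: linearB. Qed.
Lemma derZ e eta a f : der e eta (a *: f) = a *: der e eta f.
Proof. exact: linearZ_LR. Qed.

Lemma der_linl e a eta1 eta2 f :
  der e (fun x => a *: eta1 x + eta2 x) f = a *: der e eta1 f + der e eta2 f.
Proof.
apply/funext => w; rewrite serieslin /der.
elim: w f => [|y w IH] f /=.
  rewrite !addr0 big_distrr -big_split /=; apply: eq_bigr => x _.
  by rewrite smul_linl serieslin.
rewrite IH; set s1 := \sum_x _; set s2 := \sum_x _; set s3 := \sum_x _.
have -> : s1 = a * s2 + s3.
  rewrite /s1 /s2 /s3 big_distrr -big_split /=; apply: eq_bigr => x _.
  by rewrite smul_linl serieslin.
ring.
Qed.

Lemma derDl e eta1 eta2 f :
  der e (fun x => eta1 x + eta2 x) f = der e eta1 f + der e eta2 f.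
Proof.
rewrite -[X in _ = X + _]scale1r -der_linl; congr (der _ _ f).
by apply/funext => x; rewrite scale1r.
Qed.

Lemma derBl e eta1 eta2 f :
  der e (fun x => eta1 x - eta2 x) f = der e eta1 f - der e eta2 f.
Proof.
rewrite [RHS]addrC -scaleN1r -der_linl; congr (der _ _ f).
by apply/funext => x; rewrite scaleN1r addrC.
Qed.

Lemma der_eq0 e eta f : (forall x, eta x = 0) -> der e eta f = 0.
Proof.
move=> eta0; have := der_linl e (-1) eta eta f.
rewrite scaleN1r addNr => <-; congr (der _ _ f).
by apply/funext => x; rewrite eta0 scaler0 addr0.
Qed.

Lemma der_one e eta : der e eta (@sone X) = 0.
Proof.
by rewrite derE big1 // => x _; rewrite sder_one !linear0 addr0.
Qed.

Lemma der_letter e eta x : der e eta (letter x) = eta x.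
Proof.
rewrite derE (bigD1 x) //= big1 => [|y /negPf yx]; rewrite sder_letter.
  by rewrite eqxx scale1r der_one !linear0 smul1 !addr0.
by rewrite yx scale0r !linear0 addr0.
Qed.

Lemma der_linf e eta c : der e eta (linf c) = \sum_x c x *: eta x.
Proof.
by rewrite /linf linear_sum; apply: eq_bigr => x _; rewrite linearZ_LR /= der_letter.
Qed.

Lemma sign_twist_lin e : linear (sign_twist e).
Proof. by move=> a f g; apply/funext => w; rewrite /sign_twist !serieslin; ring. Qed.

HB.instance Definition _ e := GRing.isLinear.Build rat (series X) (series X)
  *:%R (sign_twist e) (@sign_twist_lin e).

Lemma sign_twist_homog e k f : shomog dg k f -> sign_twist e f = ksign (e * k) *: f.
Proof.
move=> fk; apply/funext => w; rewrite seriesZ /sign_twist.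
by have [->|/fk ->] := eqVneq (f w) 0; rewrite ?mulr0.
Qed.

Lemma sder_sign_twist e x f : sder x (sign_twist e f) = ksign (e * dg x) *: sign_twist e (sder x f).
Proof.
apply/funext => w; rewrite seriesZ /sign_twist /sder /wdeg big_cons mulrDr ksignD; ring.
Qed.

Lemma sign_twist_nil e f : sign_twist e f [::] = f [::].
Proof. by rewrite /sign_twist /wdeg big_nil mulr0 ksign0 mul1r. Qed.

Lemma derM e eta f g :
  der e eta (smul f g) = smul (der e eta f) g + smul (sign_twist e f) (der e eta g).
Proof.
pose C (p : series X * series X) := der e eta (smul p.1 p.2) -
  (smul (der e eta p.1) p.2 + smul (sign_twist e p.1) (der e eta p.2)).
suff /(_ (f, g)) : forall p, C p = 0 by move/eqP; rewrite subr_eq0 => /eqP.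
apply: (@shift_recursion0 X _ C (fun _ y => ksign (e * dg y))
  (fun y p => (sder y p.1, p.2))) => -[{}f {}g]; rewrite /C /=.
pose T h := \sum_x smul (eta x) (sder x h).
pose U h := \sum_x ksign (e * dg x) *: smul (letter x) (der e eta (sder x h)).
have dE h : der e eta h = T h + U h by rewrite derE big_split.
have -> : smul (sign_twist e f) (der e eta g) = f [::] *: der e eta g +
   \sum_y ksign (e * dg y) *: smul (letter y) (smul (sign_twist e (sder y f)) (der e eta g)).
  rewrite [sign_twist e f]series_split smulDl sign_twist_nil smulZl smul1l; congr (_ + _).
  rewrite smul_suml; apply: eq_bigr => y _.
  by rewrite sder_sign_twist linearZ_LR /= smulZl !smulA.
have -> : smul (der e eta f) g = smul (T f) g +
   \sum_y ksign (e * dg y) *: smul (letter y) (smul (der e eta (sder y f)) g).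
  rewrite dE smulDl; congr (_ + _); rewrite smul_suml; apply: eq_bigr => y _.
  by rewrite smulZl !smulA.
have -> : der e eta (smul f g) = smul (T f) g + f [::] *: der e eta g +
   \sum_y ksign (e * dg y) *: smul (letter y) (der e eta (smul (sder y f) g)).
  rewrite dE dE scalerDr.
  have -> : T (smul f g) = smul (T f) g + f [::] *: T g.
    rewrite smul_suml scaler_sumr -big_split; apply: eq_bigr => x _ /=.
    by rewrite sder_smul linearD linearZ_LR /= smulA addrC.
  have -> : U (smul f g) = f [::] *: U g +
     \sum_y ksign (e * dg y) *: smul (letter y) (der e eta (smul (sder y f) g)).
    rewrite scaler_sumr -big_split; apply: eq_bigr => x _ /=.
    by rewrite sder_smul linearP linearP scalerDr !scalerA mulrC.
  by rewrite !addrA.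
have -> : \sum_y ksign (e * dg y) *: smul (letter y)
   (der e eta (smul (sder y f) g) - (smul (der e eta (sder y f)) g +
    smul (sign_twist e (sder y f)) (der e eta g))) =
   \sum_y ksign (e * dg y) *: smul (letter y) (der e eta (smul (sder y f) g)) -
   (\sum_y ksign (e * dg y) *: smul (letter y) (smul (der e eta (sder y f)) g) +
    \sum_y ksign (e * dg y) *: smul (letter y) (smul (sign_twist e (sder y f)) (der e eta g))).
  rewrite -big_split -sumrB; apply: eq_bigr => y _ /=.
  by rewrite !(linearB, linearD).
apply/funext => w; rewrite !(seriesD, seriesN, seriesZ); ring.
Qed.

Lemma der_sbr e eta i j f g :
    (forall x, shomog dg (dg x + e) (eta x)) ->
    shomog dg i f -> shomog dg j g ->
    shomog dg (i + e) (der e eta f) -> shomog dg (j + e) (der e eta g) ->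
  der e eta (sbr dg f g) =
  sbr dg (der e eta f) g + ksign (e * i) *: sbr dg f (der e eta g).
Proof.
move=> eh fi gj dfi dgj; rewrite (sbrE fi gj) (sbrE dfi gj) (sbrE fi dgj).
rewrite linearB linearZ_LR /= !derM (sign_twist_homog _ fi) (sign_twist_homog _ gj).
rewrite !smulZl !mulrDr !mulrDl !ksignD [i * e]mulrC.
have s1 := ksign_sqr (e * i).
apply/funext => w; rewrite !(seriesD, seriesN, seriesZ).
ring: s1.
Qed.

Lemma der_homog e eta k f : (forall x, shomog dg (dg x + e) (eta x)) ->
  shomog dg k f -> shomog dg (k + e) (der e eta f).
Proof.
move=> eh fk w; apply: contraNeq => wk; apply/eqP; rewrite /der.
have sk k' h x : shomog dg k' h -> shomog dg (k' - dg x) (sder x h).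
  by move=> hk v /hk <-; rewrite /wdeg big_cons; ring.
have Th k' h x : shomog dg k' h -> shomog dg (k' + e) (smul (eta x) (sder x h)).
  move=> hk v /(shomog_smul (eh x) (sk _ _ x hk)) ->; ring.
elim: w k f fk wk => [|y w IH] k f fk wk; rewrite /= big1 ?add0r //.
- by move=> x _; apply/eqP; apply: contraNT wk => /(Th _ _ _ fk) ->.
- rewrite (IH (k - dg y)) ?mulr0 //; first exact: sk.
  apply: contraNneq wk => wk; rewrite /wdeg big_cons -/(wdeg dg w) wk; apply/eqP; ring.
- by move=> x _; apply/eqP; apply: contraNT wk => /(Th _ _ _ fk) ->.
Qed.

(** Derivations are closed under graded commutators, so identities such as D D = 0 or
    dS + Sd = E need to be checked on letters only. *)
Lemma der_comm e1 e2 eta1 eta2 f :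
    (forall x, shomog dg (dg x + e1) (eta1 x)) ->
    (forall x, shomog dg (dg x + e2) (eta2 x)) ->
  der e1 eta1 (der e2 eta2 f) =
  ksign (e1 * e2) *: der e2 eta2 (der e1 eta1 f) +
  der (e1 + e2) (fun x => der e1 eta1 (eta2 x)
                          - ksign (e1 * e2) *: der e2 eta2 (eta1 x)) f.
Proof.
move=> h1 h2; apply/eqP; rewrite -subr_eq0; apply/eqP.
set eta3 := fun x => _.
have eta3E x : eta3 x = der e1 eta1 (eta2 x) - ksign (e1 * e2) *: der e2 eta2 (eta1 x) by [].
move: eta3 eta3E => eta3 eta3E.
apply: (@shift_recursion0 X _ (fun f => der e1 eta1 (der e2 eta2 f) -
  (ksign (e1 * e2) *: der e2 eta2 (der e1 eta1 f) + der (e1 + e2) eta3 f))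
  (fun _ y => ksign ((e1 + e2) * dg y)) (fun y f => sder y f)) => {}f.
rewrite [der e2 eta2 f]derE [der e1 eta1 f]derE [der (e1 + e2) eta3 f]derE.
rewrite !linear_sum -big_split -sumrB; apply: eq_bigr => x _ /=.
rewrite !(derD, derZ) !derM !der_letter eta3E.
rewrite (sign_twist_homog _ (h1 x)) (sign_twist_homog _ (h2 x)).
have letx : shomog dg (dg x) (letter x) by exact/lie_poly_homog/lie_letter.
rewrite !(sign_twist_homog _ letx) !smulZl.
rewrite !(smulBl, smulDr, smulNr, smulZr, smulZl) [e2 * (_ + _)]mulrDr [e1 * (_ + _)]mulrDr.
rewrite [(_ + _) * dg x]mulrDl !ksignD [e2 * e1]mulrC.
have s1 := ksign_sqr (e1 * e2).
apply/funext => w; rewrite !(seriesD, seriesN, seriesZ).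
ring: s1.
Qed.

Lemma der_sqr eta f : (forall x, shomog dg (dg x - 1) (eta x)) ->
  der (-1) eta (der (-1) eta f) = der (-2) (fun x => der (-1) eta (eta x)) f.
Proof.
move=> h; have := der_comm f h h.
rewrite -[ksign _]/(-1 : rat) -[-1 + -1 : int]/(-2 : int).
set a := der (-1) eta (der _ _ f).
have -> : (fun x => der (-1) eta (eta x) - (-1) *: der (-1) eta (eta x)) =
          (fun x => 2 *: der (-1) eta (eta x) + 0).
  by apply/funext => x; rewrite scaleN1r opprK addr0 scaler_nat mulr2n.
rewrite der_linl => /(congr1 (fun u => u + a)).
rewrite [der (-2) (fun=> 0) f]der_eq0 // addr0 scaleN1r addrAC addNr add0r -mulr2n -scaler_nat.
by apply: scalerI; rewrite pnatr_eq0.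
Qed.

Lemma sbr_tw k c f : shomog dg k c ->
  sbr dg c f = smul c f - smul (sign_twist k f) c.
Proof.
move=> ck; apply/funext => w; rewrite seriesB /sbr /smul -sumrB.
apply: eq_bigr => i _; congr (_ - _); rewrite /sign_twist mulrA.
by have [->|/ck ->] := eqVneq (c (drop i w)) 0; rewrite ?mulr0 // [k * _]mulrC.
Qed.

Lemma der_ad k c f : shomog dg k c -> der k (fun x => sbr dg c (letter x)) f = sbr dg c f.
Proof.
move=> ck; apply/eqP; rewrite -subr_eq0; apply/eqP.
apply: (@shift_recursion0 X _ (fun f => der k (fun x => sbr dg c (letter x)) f - sbr dg c f)
  (fun _ y => ksign (k * dg y)) (fun y f => sder y f)) => {}f.
have -> : sbr dg c f = \sum_x (smul (smul c (letter x)) (sder x f) -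
    ksign (k * dg x) *: smul (letter x) (smul (sign_twist k (sder x f)) c)).
  rewrite (sbr_tw _ ck) {1}[f]series_split [sign_twist k f]series_split sign_twist_nil.
  rewrite smulDr smulDl smulZr smulZl smul1 smul1l opprD addrACA subrr add0r.
  rewrite linear_sum smul_suml -sumrB; apply: eq_bigr => x _ /=.
  by rewrite sder_sign_twist smulZr smulZl !smulA.
rewrite derE -sumrB; apply: eq_bigr => x _ /=.
have letx : shomog dg (dg x) (letter x) by exact/lie_poly_homog/lie_letter.
rewrite !(sbr_tw _ ck) (sign_twist_homog _ letx) !(smulBl, smulBr, smulDr, smulNr, smulZl) !smulA.
apply/funext => w; rewrite !(seriesD, seriesN, seriesZ); ring.
Qed.

Lemma ord_sder a x f : ord_ge a f -> ord_ge a.-1 (sder x f).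
Proof. by move=> fa w wa; apply: fa => /=; lia. Qed.

Lemma ord_der e eta a b f : ord_ge a f -> (forall x, ord_ge b (eta x)) ->
  ord_ge (a.-1 + b)%N (der e eta f).
Proof.
move=> + eb w; rewrite /der; elim: w a f => [|y w IH] a f fa wab /=.
  rewrite addr0 big1 // => x _; apply: (ord_smul (eb x) (ord_sder x fa)).
  by rewrite addnC.
rewrite big1 => [|x _].
  by rewrite add0r (IH a.-1) ?mulr0 //; [exact: ord_sder | move: wab => /=; lia].
by apply: (ord_smul (eb x) (ord_sder x fa)); rewrite addnC.
Qed.

Lemma supp_der (P : pred X) e eta f : (forall x, P x -> supported P (eta x)) ->
  supported P f -> supported P (der e eta f).
Proof.
move=> eP + w; rewrite /der; elim: w f => [|y w IH] f fP wP //.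
rewrite /= big1 => [|x _].
  have [yP|yP] := boolP (P y).
    by rewrite IH ?mulr0 ?add0r //; [exact: supp_sder | move: wP; rewrite /= yP].
  by rewrite (supp_sder0 fP yP) -/(der e eta 0) linear0 mulr0 addr0.
have [xP|xP] := boolP (P x); last by rewrite (supp_sder0 fP xP) linear0.
by apply: supp_smul wP; [exact: eP | exact: supp_sder].
Qed.

(** By invariance of f, the values of eta on vertices matter only through their
    differences. *)
Lemma inv_der (vx : pred X) a0 e eta f : vx a0 ->
    (forall x, vx x -> dg x = dg a0) ->
    (forall x, ~~ vx x -> invariant vx (eta x)) ->
    (forall x, vx x -> invariant vx (eta x - eta a0)) ->
  invariant vx f -> invariant vx (der e eta f).
Proof.
move=> va dv en ev fi.
pose T h := \sum_x smul (eta x) (sder x h).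
have Ti h : invariant vx h -> invariant vx (T h).
  move=> hi; rewrite /T (bigID vx) /=; apply: invD; last first.
    by apply: inv_sum => x /en ex; apply: inv_smul => //; exact: inv_sder.
  have -> : \sum_(x | vx x) smul (eta x) (sder x h) =
            \sum_(x | vx x) smul (eta x - eta a0) (sder x h).
    under [RHS]eq_bigr do rewrite smulBl.
    by rewrite sumrB -linear_sum inv_sum_sder // linear0 subr0.
  by apply: inv_sum => x /ev ex; apply: inv_smul => //; exact: inv_sder.
have dT h z w : der e eta h (z :: w) =
    T h (z :: w) + ksign (e * dg z) * der e eta (sder z h) w.
  by rewrite /T series_sum.
move=> p s; elim: p f fi => [|y p IH] f fi /=; under eq_bigr do rewrite dT.
  rewrite big_split /= (Ti _ fi [::]) add0r.
  rewrite (eq_bigr (fun x => ksign (e * dg a0) * der e eta (sder x f) s)) => [|x /dv -> //].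
  rewrite -big_distrr /= -[X in _ * X](series_sum _ _ (fun x => der e eta (sder x f))).
  by rewrite -linear_sum inv_sum_sder // linear0 mulr0.
by rewrite big_split /= (Ti _ fi (y :: p)) -big_distrr /= IH ?mulr0 ?addr0 //; exact: inv_sder.
Qed.

Lemma lie_seriesZ k a f : lie_series dg k f -> lie_series dg k (a *: f).
Proof.
move=> fk; rewrite -[a *: f]addr0; apply: lie_series_lin => //.
exact/lie_poly_series/lie_zero.
Qed.

Lemma lie_seriesD k f g : lie_series dg k f -> lie_series dg k g -> lie_series dg k (f + g).
Proof. by move=> fk gk; rewrite -[f]scale1r; exact: lie_series_lin. Qed.

Lemma lie_seriesB k f g : lie_series dg k f -> lie_series dg k g -> lie_series dg k (f - g).
Proof. by move=> fk gk; rewrite addrC -scaleN1r; exact: lie_series_lin. Qed.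

Lemma lie_series_sum k (I : Type) (r : seq I) (P : pred I) (F : I -> series X) :
  (forall i, P i -> lie_series dg k (F i)) -> lie_series dg k (\sum_(i <- r | P i) F i).
Proof.
move=> Fk; elim/big_ind: _ => //; last exact: lie_seriesD.
exact/lie_poly_series/lie_zero.
Qed.

Lemma lie_series_linf k c : (forall x, c x != 0 -> dg x = k) -> lie_series dg k (linf c).
Proof.
move=> ck; apply: lie_series_sum => x _.
have [->|/ck <-] := eqVneq (c x) 0.
  by rewrite scale0r; exact/lie_poly_series/lie_zero.
exact/lie_seriesZ/lie_poly_series/lie_letter.
Qed.

Lemma lie_poly_ord k f : lie_poly dg k f -> ord_ge 1 f.
Proof.
elim=> {k f} [x|k|k a f g _ fk _ gk|i j f g _ fi _ gj] //.
- by case.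
- exact: ord_lin.
case=> // _; rewrite /sbr big_ord_recl big_ord0 /= fi // gj //.
by rewrite !mul0r mulr0 subr0 addr0.
Qed.

Lemma lie_series_ord k f : lie_series dg k f -> ord_ge 1 f.
Proof.
by move=> fk w w1; have [p [/lie_poly_ord pk ->]] := fk 0 => //; exact: pk.
Qed.

Lemma lie_series_der e eta k f : (forall x, lie_series dg (dg x + e) (eta x)) ->
  lie_series dg k f -> lie_series dg (k + e) (der e eta f).
Proof.
move=> el fk N.
have eh x : shomog dg (dg x + e) (eta x) by apply/lie_series_homog.
have poly_case j p : lie_poly dg j p -> lie_series dg (j + e) (der e eta p).
  elim=> {j p} [x|j|j a p q _ IHp _ IHq|i j p q pi IHp qj IHq].
  - by rewrite der_letter.
  - by rewrite linear0; exact/lie_poly_series/lie_zero.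
  - by rewrite linearP; exact: lie_series_lin.
  - have ph := lie_poly_homog pi; have qh := lie_poly_homog qj.
    rewrite (der_sbr eh ph qh (der_homog eh ph) (der_homog eh qh)).
    apply: lie_seriesD; last apply: lie_seriesZ.
      rewrite addrAC; apply: lie_series_br => //; exact: lie_poly_series.
    rewrite -addrA; apply: lie_series_br => //; exact: lie_poly_series.
have [p [pk fp]] := fk N; have [q [qk pq]] := poly_case _ _ pk N.
exists q; split=> // w wN; rewrite -pq //.
apply/eqP; rewrite -subr_eq0 -seriesB -linearB; apply/eqP.
have fpo : ord_ge N.+1 (f - p) by move=> v vN; rewrite seriesB fp ?subrr.
by apply: (ord_der e fpo (fun x => lie_series_ord (el x))) => /=; rewrite addn1.
Qed.

Lemma lie_series_lim k f : (forall N, exists2 g, lie_series dg k g & ord_ge N (f - g)) ->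
  lie_series dg k f.
Proof.
move=> H N; have [g gk fg] := H N.+1; have [p [pk gp]] := gk N.
exists p; split=> // w wN; rewrite -gp //.
by apply/eqP; rewrite -subr_eq0 -seriesB; apply/eqP; exact: fg.
Qed.

End Derivations.
(** * Completeness *)
Section Completeness.
Variables (X : finType) (dg : X -> int).
Implicit Types (f g h : series X) (w : seq X).

Inductive right_normed : nat -> int -> series X -> Prop :=
| rn_letter x : right_normed 1 (dg x) (letter x)
| rn_zero l k : right_normed l k 0
| rn_lin l k (a : rat) f g :
    right_normed l k f -> right_normed l k g -> right_normed l k (a *: f + g)
| rn_ad l k x f :
    right_normed l k f -> right_normed l.+1 (dg x + k) (sbr dg (letter x) f).

Lemma rn_lie_poly l k f : right_normed l k f -> lie_poly dg k f.
Proof.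
elim=> {l k f} [x|l k|l k a f g _ fk _ gk|l k x f _ fk].
- exact: lie_letter.
- exact: lie_zero.
- exact: lie_lin.
- by apply: lie_br => //; exact: lie_letter.
Qed.

Lemma sbr0 h : sbr dg h 0 = 0.
Proof.
by rewrite -[0 in LHS](scaler0 _ (-1 : rat)) -[X in sbr _ _ X]addr0 sbr_linr scaleN1r addNr.
Qed.

Lemma sbr0l h : sbr dg 0 h = 0.
Proof.
by rewrite -[0 in LHS](scaler0 _ (-1 : rat)) -[X in sbr _ X]addr0 sbr_linl scaleN1r addNr.
Qed.

Lemma sbr_size x h w n : size w = n.+1 -> (forall v, size v = n -> h v = 0) ->
  sbr dg (letter x) h w = 0.
Proof.
move=> wn hn; rewrite /sbr big1 // => i _.
have lE v : size v != 1 -> letter x v = 0.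
  by rewrite /letter; case: (v =P [:: x]) => [->|].
have sz := congr1 size (cat_take_drop i w); rewrite size_cat in sz.
have [t1|t1] := eqVneq (size (take i w)) 1.
  have d1 : size (drop i w) = n by lia.
  rewrite (hn _ d1) mulr0 sub0r; have [d2|d2] := eqVneq (size (drop i w)) 1.
    by rewrite (hn (take i w)) ?mul0r ?mulr0 ?oppr0 // t1 -d1 d2.
  by rewrite (lE _ d2) !mulr0 oppr0.
rewrite (lE _ t1) mul0r sub0r; have [d2|d2] := eqVneq (size (drop i w)) 1.
  by rewrite hn ?mul0r ?mulr0 ?oppr0 //; lia.
by rewrite (lE _ d2) !mulr0 oppr0.
Qed.

Lemma rn_size l k f : right_normed l k f -> forall w, size w != l -> f w = 0.
Proof.
elim=> {l k f} [x|l k|l k a f g _ fk _ gk|l k x f _ fk] w wl //.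
- by rewrite /letter; case: (w =P [:: x]) wl => [->|].
- by rewrite serieslin fk ?gk ?mulr0 ?addr0.
- case sw: (size w) wl => [|n] wl; last first.
    by apply: (sbr_size _ sw) => v vn; apply: fk; rewrite vn.
  case: w sw => // _; rewrite /sbr big_ord_recl big_ord0 /= /letter /=.
  by rewrite mul0r !mulr0 subr0 addr0.
Qed.

(** By the Jacobi identity, the bracket with a bracket of x and f is the commutator of
    the brackets with x and with f; this allows induction on the left argument. *)
Lemma rn_br l m i j f g : right_normed l i f -> right_normed m j g ->
  right_normed (l + m)%N (i + j) (sbr dg f g).
Proof.
move=> fl; elim: fl m j g => {l i f} [x|l i|l i a f1 f2 _ IH1 _ IH2|l i x f fl IH] m j g gm.
- by rewrite add1n; exact: rn_ad.
- by rewrite sbr0l; exact: rn_zero.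
- by rewrite sbr_linl; apply: rn_lin; [exact: IH1 | exact: IH2].
have xh : shomog dg (dg x) (letter x) by exact/lie_poly_homog/lie_letter.
have fh := lie_poly_homog (rn_lie_poly fl).
have gh := lie_poly_homog (rn_lie_poly gm).
have -> : sbr dg (sbr dg (letter x) f) g = (- ksign (dg x * i)) *:
    sbr dg f (sbr dg (letter x) g) + sbr dg (letter x) (sbr dg f g).
  rewrite (sbr_jacobi xh fh gh) scaleNr addrC -addrA subrr addr0 //.
apply: rn_lin; last by rewrite addSn -addrA; exact/rn_ad/IH.
have -> : (l.+1 + m = l + m.+1)%N by rewrite addnS.
have -> : dg x + i + j = i + (dg x + j) by rewrite addrCA addrA.
exact/IH/rn_ad.
Qed.

Lemma lie_poly_rn k f : lie_poly dg k f -> Defs.span (fun g => exists l, right_normed l k g) f.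
Proof.
elim=> {k f} [x|k|k a f g _ IHf _ IHg|i j f g _ IHf _ IHg].
- by apply: span_incl; exists 1; exact: rn_letter.
- exact: span_zero.
- by apply: spanD IHg; exact: spanZ.
elim: IHf => [|a f1 f2 [l f1l] _ IH]; first by rewrite sbr0l; exact: span_zero.
rewrite sbr_linl; apply: spanD IH; apply: spanZ.
elim: IHg => [|b g1 g2 [m g1m] _ IH]; first by rewrite sbr0; exact: span_zero.
rewrite sbr_linr; apply: spanD IH; apply/spanZ/span_incl.
by exists (l + m)%N; exact: rn_br.
Qed.

Definition component l f : series X := fun w => if size w == l then f w else 0.

(** Brackets of letters are homogeneous for word length, so each length component of a
    Lie series is a Lie polynomial; right-normed form is what can be divided by the
    first letter afterwards. *)
Lemma component_rn l k f : lie_series dg k f -> right_normed l k (component l f).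
Proof.
move=> fk; have [p [pk fp]] := fk l.
have -> : component l f = component l p.
  by apply/funext => w; rewrite /component; case: eqP => // wl; rewrite fp // wl.
elim: (lie_poly_rn pk) => [|a f1 f2 [m f1m] _ IH].
  rewrite (_ : component l 0 = 0); first exact: rn_zero.
  by apply/funext => w; rewrite /component; case: eqP.
rewrite (_ : component l _ = a *: component l f1 + component l f2); last first.
  apply/funext => w; rewrite serieslin /component; case: eqP => //.
  by rewrite mulr0 addr0.
apply: rn_lin IH; have [<-|ml] := eqVneq m l.
  rewrite (_ : component m f1 = f1) //.
  apply/funext => w; rewrite /component; case: eqP => // /eqP wm.
  by rewrite (rn_size f1m wm).
rewrite (_ : component l f1 = 0); first exact: rn_zero.
apply/funext => w; rewrite /component; case: eqP => // wl.
by rewrite (rn_size f1m) // wl eq_sym.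
Qed.

Lemma rn_ad_decomposition l k f : right_normed l.+2 k f ->
  exists g : X -> series X, (forall x, right_normed l.+1 (k - dg x) (g x)) /\
    f = \sum_x sbr dg (letter x) (g x).
Proof.
move E: l.+2 => n fn; elim: fn E => {n k f} [x|n k|n k a f1 f2 _ IH1 _ IH2|n k x f fn _] E.
- by [].
- exists (fun=> 0); split=> [x|]; first exact: rn_zero.
  by rewrite big1 // => x _; exact: sbr0.
- have [g1 [g1n ->]] := IH1 E; have [g2 [g2n ->]] := IH2 E.
  exists (fun x => a *: g1 x + g2 x); split=> [x|]; first exact: rn_lin.
  rewrite scaler_sumr -big_split; apply: eq_bigr => x _.
  by rewrite sbr_linr.
case: E => E; exists (fun y => if y == x then f else 0); split=> [y|].
  case: eqP => [->|_]; last exact: rn_zero.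
  by rewrite addrC addKr E.
rewrite (bigD1 x) //= eqxx big1 ?addr0 // => y /negPf ->; exact: sbr0.
Qed.

Lemma ord_sbr a b f g : ord_ge a f -> ord_ge b g -> ord_ge (a + b)%N (sbr dg f g).
Proof.
move=> fa gb w wab; rewrite /sbr big1 // => i _.
have := congr1 size (cat_take_drop i w); rewrite size_cat => sw.
have -> : f (take i w) * g (drop i w) = 0.
  have [lt|ge] := ltnP (size (take i w)) a; first by rewrite fa // mul0r.
  by rewrite gb ?mulr0 //; lia.
have -> : g (take i w) * f (drop i w) = 0.
  have [lt|ge] := ltnP (size (take i w)) b; first by rewrite gb // mul0r.
  by rewrite fa ?mulr0 //; lia.
by rewrite mulr0 subr0.
Qed.

(** In each length take a right-normed expression and strip its first letters; these
    choices for different lengths add up to series since the letters are finitely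
    many. A zero component is expanded by zeros, which gives the bound on the
    order. *)
Lemma lie_series_ad_decomposition k f : lie_series dg k f -> ord_ge 2 f ->
  exists g : X -> series X, [/\ forall x, lie_series dg (k - dg x) (g x),
    forall m x, ord_ge m.+1 f -> ord_ge m (g x)
    & f = \sum_x sbr dg (letter x) (g x)].
Proof.
move=> fk f2.
have Gex l : {G : X -> series X | [/\ forall x, right_normed l.+1 (k - dg x) (G x),
    component l.+2 f = 0 -> forall x, G x = 0
    & component l.+2 f = \sum_x sbr dg (letter x) (G x)]}.
  apply: cid; have [f0|f0] := pselect (component l.+2 f = 0).
    exists (fun=> 0); split=> // [x|]; first exact: rn_zero.
    by rewrite f0 big1 // => x _; exact: sbr0.
  have [G [Gl fG]] := rn_ad_decomposition (component_rn l.+2 fk).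
  by exists G; split.
pose G l := sval (Gex l).
pose g x : series X := fun w => if size w is l.+1 then G l x w else 0.
have Grn l x : right_normed l.+1 (k - dg x) (G l x).
  by rewrite /G; case: (svalP (Gex l)).
exists g; split=> [x|m x fm w wm|].
- move=> N; exists (\sum_(l < N) G l x); split.
    elim/big_ind: _ => [|u v uk vk|l _]; first exact: lie_zero.
      by rewrite -[u]scale1r; exact: lie_lin.
    exact: rn_lie_poly (Grn l x).
  move=> w wN; rewrite series_sum /g; case sw: (size w) => [|l].
    by rewrite big1 // => l _; rewrite (rn_size (Grn l x)) // sw.
  have lN : (l < N)%N by rewrite -sw.
  rewrite (bigD1 (Ordinal lN)) //= big1 ?addr0 // => j jl.
  by rewrite (rn_size (Grn j x)) // sw eqSS eq_sym.
- rewrite /g; case sw: (size w) => [//|l].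
  rewrite /G; case: (svalP (Gex l)) => _ -> //.
  by apply/funext => v; rewrite /component; case: eqP => // vl; rewrite fm // vl -sw.
apply/funext => w; rewrite series_sum; case sw: (size w) => [|[|l]].
- rewrite f2 ?sw // big1 // => x _.
  rewrite (@ord_sbr 1 0) ?sw //; case=> //.
- rewrite f2 ?sw // big1 // => x _; apply: (sbr_size _ sw) => v v0.
  by rewrite /g v0.
have -> : f w = component l.+2 f w by rewrite /component sw eqxx.
rewrite /G; case: (svalP (Gex l)) => _ _ ->; rewrite series_sum.
apply: eq_bigr => x _; apply/eqP; rewrite -subr_eq0 -seriesB.
have -> : sbr dg (letter x) (G l x) - sbr dg (letter x) (g x) =
          sbr dg (letter x) (- 1 *: g x + G l x).
  by rewrite sbr_linr scaleN1r addrC.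
by apply/eqP/(sbr_size _ sw) => v vl; rewrite serieslin /g vl mulN1r addNr.
Qed.

Lemma hat_lie_ord f : f \in hat_lie dg -> ord_ge 1 f.
Proof.
move=> /hat_lieP; elim=> [|a f1 f2 [k f1k] _ IH] //.
by apply: ord_lin IH; exact: lie_series_ord f1k.
Qed.

Lemma span_sum (V : lmodType rat) (S : V -> Prop) (I : Type) (r : seq I) (F : I -> V) :
  (forall i, S (F i)) -> Defs.span S (\sum_(i <- r) F i).
Proof.
move=> SF; elim/big_ind: _ => [|u v|i _]; [exact: span_zero | exact: spanD |].
exact: span_incl.
Qed.

Lemma ser_bigsum (I : Type) (r : seq I) (F : I -> hatL dg) :
  ser (\sum_(i <- r) F i) = \sum_(i <- r) ser (F i).
Proof. exact: (big_morph (fun f : hatL dg => ser f)). Qed.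

(** Together with [ord_lcs]: the lower central series of the free complete Lie algebra
    is its filtration by word length, so limits may be taken coefficientwise. *)
Lemma lcs_ord m (f : hatL dg) : lcs m f -> ord_ge m.+1 (ser f).
Proof.
elim: m f => [|m IH] f; first by move=> _; exact: hat_lie_ord (serP f).
rewrite /=; elim=> [|a u v [x [y [/IH yo ->]]] _ vo] //.
apply: ord_lin vo; exact: (@ord_sbr 1 m.+1) (hat_lie_ord (serP x)) yo.
Qed.

Lemma ord_lcs m k (f : hatL dg) : homog k f -> ord_ge m.+1 (ser f) -> lcs m f.
Proof.
elim: m k f => [|m IH] k f fk fo //.
have [g [gk go fE]] := lie_series_ad_decomposition fk (ord_le (isT : 2 <= m.+2)%N fo).
have gP x : g x \in hat_lie dg by apply/hat_lieP/span_incl; exists (k - dg x).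
have -> : f = \sum_x br (gen dg x) (HatCar (gP x)).
  by apply: val_inj; rewrite /= ser_bigsum fE.
apply: span_sum => x; exists (gen dg x), (HatCar (gP x)); split=> //.
apply: (IH (k - dg x)); first exact: gk.
exact: go.
Qed.

Theorem hatL_complete : complete (hatL dg).
Proof.
move=> k x xk xc.
have xo m j : ord_ge m.+1 (ser (x (m + j)%N) - ser (x m)).
  elim: j => [|j IH]; first by rewrite addn0 subrr.
  rewrite -(subrKA (ser (x (m + j)%N))) addnS; apply: ordD IH.
  by apply: ord_le (lcs_ord (xc (m + j)%N)); rewrite ltnS leq_addr.
pose y : series X := fun w => ser (x (size w)) w.
have yo m : ord_ge m.+1 (y - ser (x m)).
  move=> w wm; rewrite seriesB /y; have := xo (size w) (m - size w)%N w (leqnn _).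
  by rewrite subnKC // seriesB => /eqP; rewrite subr_eq0 => /eqP ->; rewrite subrr.
have yk : lie_series dg k y.
  apply: lie_series_lim => N; exists (ser (x N)); first exact: xk.
  by apply: ord_le (yo N).
have yP : y \in hat_lie dg by apply/hat_lieP/span_incl; exists k.
exists (HatCar yP); split.
  split=> // m; apply: (@ord_lcs m k); last exact: yo.
  rewrite addrC -[- x m]scaleN1r; apply: homog_lin; [exact: xk | exact: yk].
move=> z [zk zx]; apply/val_inj => /=; apply/eqP; rewrite -subr_eq0; apply/eqP.
apply: ord_all0 => N; rewrite -(subrKA (ser (x N))).
apply: ordD; first by apply: ord_le (yo N).
rewrite -opprB -scaleN1r; apply: ordZ.
by apply: ord_le (lcs_ord (zx N)).
Qed.

End Completeness.
(** * Successive corrections *)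
Section Limits.
Variable X : finType.
Implicit Types f g u v : series X.

Lemma iterative_correction (P : nat -> series X -> Prop) u0 :
  P 0%N u0 ->
  (forall N u, P N u -> exists2 v, ord_ge N v & P N.+1 (u - v)) ->
  exists u, forall N, exists2 v, P N v & ord_ge N (u - v).
Proof.
move=> P0 step.
have next N u : {v | P N u -> ord_ge N v /\ P N.+1 (u - v)}.
  apply: cid; have [/step[v v1 v2]|nP] := pselect (P N u); first by exists v.
  by exists 0.
pose fix seq_ N := if N is N'.+1 then seq_ N' - sval (next N' (seq_ N')) else u0.
have seqP N : P N (seq_ N).
  by elim: N => //= N IH; case: (svalP (next N (seq_ N)) IH).
have seqS N k : ord_ge N (seq_ N - seq_ (N + k)%N).
  elim: k => [|k IH]; first by rewrite addn0 subrr.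
  have [vo _] := svalP (next _ (seq_ (N + k)%N)) (seqP _).
  rewrite addnS /= opprB addrCA; apply: ordD IH; apply: ord_le vo; exact: leq_addr.
exists (fun w => seq_ (size w).+1 w) => N; exists (seq_ N) => // w wN.
have := seqS (size w).+1 (N - (size w).+1)%N w (leqnn _).
by rewrite subnKC // => ->.
Qed.

End Limits.

(** * Contraction of the linear differential *)

(** In this section d is the linear part of a differential, s a candidate contraction,
    M the set of letters allowed in the series considered, and Z the set of letters of
    M on which the contraction fails to be one. *)
Section Contraction.
Variables (X : finType) (dg : X -> int).
Variables (vx : pred X) (a0 : X) (M Z : pred X) (d s : X -> X -> rat).
Hypothesis va : vx a0.
Hypothesis dv : forall x, vx x -> dg x = dg a0.
Hypothesis ddeg : forall x y, d x y != 0 -> dg y = dg x - 1.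
Hypothesis sdeg : forall x y, s x y != 0 -> dg y = dg x + 1.
Hypothesis d_inv : forall x, ~~ vx x -> invariant vx (linf (d x)).
Hypothesis d_vx : forall x y, vx x -> d x y = 0.
Hypothesis s_vx : forall x y, vx y -> s x y = 0.
Hypothesis dM : forall x y, M x -> ~~ M y -> d x y = 0.
Hypothesis sM : forall x y, M x -> ~~ M y -> s x y = 0.
Hypothesis d_sqr : forall x z, \sum_y d x y * d y z = 0.

Definition homotopy_coef x y := \sum_z (s x z * d z y + d x z * s z y).

Hypothesis Za0 : ~~ Z a0.
Hypothesis homotopy_id : forall x y, M x -> ~~ Z x -> y != a0 ->
  homotopy_coef x y = (x == y)%:R.
Hypothesis homotopy_Z : forall x y, M x -> Z x -> Z y -> homotopy_coef x y = 0.

Definition admissible k f := [/\ lie_series dg k f, invariant vx f & supported M f].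

Definition dlin := der dg (-1) (fun x => linf (d x)).
Definition slin := der dg 1 (fun x => linf (s x)).
Definition elin := der dg 0 (fun x => linf (homotopy_coef x)).

Lemma lie_d x : lie_series dg (dg x - 1) (linf (d x)).
Proof. by apply: lie_series_linf => y /ddeg. Qed.

Lemma lie_s x : lie_series dg (dg x + 1) (linf (s x)).
Proof. by apply: lie_series_linf => y /sdeg. Qed.

Lemma admissible_lin k a f g : admissible k f -> admissible k g -> admissible k (a *: f + g).
Proof.
by case=> ? ? ? [? ? ?]; split; [exact: lie_series_lin|exact: inv_lin|exact: supp_lin].
Qed.

Lemma admissible0 k : admissible k 0.
Proof.
by split; [exact/lie_poly_series/lie_zero | exact: inv0 | exact: supp0].
Qed.

Lemma admissibleZ k a f : admissible k f -> admissible k (a *: f).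
Proof. by move=> fk; rewrite -[_ *: _]addr0; apply: admissible_lin => //; exact: admissible0. Qed.

Lemma admissibleD k f g : admissible k f -> admissible k g -> admissible k (f + g).
Proof. by move=> fk; rewrite -[f]scale1r; exact: admissible_lin. Qed.

Lemma admissibleB k f g : admissible k f -> admissible k g -> admissible k (f - g).
Proof. by move=> fk gk; rewrite addrC -scaleN1r; exact: admissible_lin. Qed.

Lemma linf0 (c : X -> rat) : (forall x, c x = 0) -> linf c = 0.
Proof. by move=> c0; rewrite /linf big1 // => x _; rewrite c0 scale0r. Qed.

Lemma admissible_dlin k f : admissible k f -> admissible (k - 1) (dlin f).
Proof.
case=> fl fi fM; split.
- exact: lie_series_der lie_d fl.
- apply: (@inv_der _ _ vx a0 _ (fun x => linf (d x)) _ va dv d_inv _ fi) => x vxx.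
  rewrite !(linf0 (fun y => d_vx _ _)) ?subrr //.
  exact: inv0.
- by apply: supp_der fM => x Mx; apply: supp_linf => y; exact: dM.
Qed.

Lemma admissible_slin k f : admissible k f -> admissible (k + 1) (slin f).
Proof.
have si x : invariant vx (linf (s x)).
  by apply: inv_linf; rewrite big1 // => y; exact: s_vx.
case=> fl fi fM; split.
- exact: lie_series_der lie_s fl.
- by apply: (@inv_der _ _ vx a0 _ (fun x => linf (s x)) _ va dv _ _ fi) => // x vxx; apply: invB.
- by apply: supp_der fM => x Mx; apply: supp_linf => y; exact: sM.
Qed.

Lemma linf_comp (c : X -> rat) (m : X -> X -> rat) :
  \sum_y c y *: linf (m y) = linf (fun z => \sum_y c y * m y z).
Proof.
rewrite /linf; under eq_bigr do rewrite scaler_sumr.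
rewrite exchange_big; apply: eq_bigr => z _; rewrite scaler_suml.
by apply: eq_bigr => y _; rewrite scalerA.
Qed.

Lemma dlin_sqr f : dlin (dlin f) = 0.
Proof.
rewrite /dlin der_sqr => [|x]; last exact/lie_series_homog/lie_d.
by apply: der_eq0 => x; rewrite der_linf linf_comp linf0.
Qed.

(** The homotopy formula: both sides are derivations. *)
Lemma elinE f : elin f = dlin (slin f) + slin (dlin f).
Proof.
rewrite /dlin /slin der_comm.
- rewrite -[ksign _]/(-1 : rat) scaleN1r addrC addrA subrr add0r.
  rewrite -[-1 + 1 : int]/(0 : int); congr (der _ _ _ f); apply/funext => x.
  rewrite scaleN1r opprK !der_linf !linf_comp.
  rewrite /linf -big_split /=; apply: eq_bigr => y _.
  by rewrite -scalerDl /homotopy_coef big_split.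
- by move=> x; exact/lie_series_homog/lie_d.
- by move=> x; exact/lie_series_homog/lie_s.
Qed.

(** E is triangular for the number of letters in Z: it fixes a letter outside Z up to a
    multiple of a0, and sends a letter of Z to letters outside Z. *)
Lemma elin_diag f w : a0 \notin w -> supported M f ->
  (forall v, size v = size w -> a0 \notin v -> (count Z w < count Z v)%N -> f v = 0) ->
  elin f w = (size w - count Z w)%:R * f w.
Proof.
rewrite /elin /der; elim: w f => [|y w IH] f aw fM fZ.
  by rewrite /= mul0r addr0 big1 // => x _; rewrite smul_linf_nil.
move: aw; rewrite inE negb_or => /andP[ay aw]; have ya : y != a0 by rewrite eq_sym.
have -> : der_coef dg 0 (fun x => linf (homotopy_coef x)) f (y :: w) =
    \sum_x homotopy_coef x y * f (x :: w) +
    der_coef dg 0 (fun x => linf (homotopy_coef x)) (sder y f) w.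
  rewrite /= mul0r ksign0 mul1r; congr (_ + _).
  by apply: eq_bigr => x _; rewrite smul_linf_cons.
have -> : \sum_x homotopy_coef x y * f (x :: w) = (~~ Z y)%:R * f (y :: w).
  have [Zy|Zy] := boolP (Z y).
    rewrite mul0r big1 // => x _.
    have [Mx|Mx] := boolP (M x); last by rewrite fM ?mulr0 //= negb_and Mx.
    have [Zx|Zx] := boolP (Z x); first by rewrite homotopy_Z ?mul0r.
    by rewrite homotopy_id //; case: eqP Zx Zy => [->|]; rewrite ?mul0r // => /negPf ->.
  rewrite mul1r (bigD1 y) //= big1 => [|x xy].
    have [My|My] := boolP (M y); last by rewrite fM ?mulr0 ?addr0 //= negb_and My.
    by rewrite homotopy_id // eqxx mul1r addr0.
  have [Mx|Mx] := boolP (M x); last by rewrite fM ?mulr0 //= negb_and Mx.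
  have [Zx|Zx] := boolP (Z x).
    rewrite fZ ?mulr0 //=; last by rewrite Zx (negPf Zy).
    by rewrite inE negb_or aw andbT; apply: contraNneq Za0 => ->.
  by rewrite homotopy_id // (negPf xy) mul0r.
rewrite IH //; last first.
- by move=> v vw av cv; apply: fZ; rewrite /= ?vw ?ltn_add2l // inE negb_or ay.
- exact: supp_sder.
have := count_size Z w; rewrite /= /sder.
case: (Z y) => /= cw; rewrite ?mul0r ?add0r ?mul1r ?add1n ?subSS //.
by rewrite add0n subSn // -natr1 mulrDl mul1r addrC.
Qed.

Lemma admissible_elin k f : admissible k f -> admissible k (elin f).
Proof.
move=> fk; rewrite elinE; apply: admissibleD.
- by have := admissible_dlin (admissible_slin fk); rewrite addrK.
- by have := admissible_slin (admissible_dlin fk); rewrite subrK.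
Qed.

Lemma ord_elin l f : ord_ge l f -> ord_ge l (elin f).
Proof.
by move=> fo; apply: (ord_le _ (ord_der _ _ fo (fun x => @ord_linf _ (homotopy_coef x)))); lia.
Qed.

Lemma ord_slin l f : ord_ge l f -> ord_ge l (slin f).
Proof. by move=> fo; apply: (ord_le _ (ord_der _ _ fo (fun x => @ord_linf _ (s x)))); lia. Qed.

Lemma ord_dlin l f : ord_ge l f -> ord_ge l (dlin f).
Proof. by move=> fo; apply: (ord_le _ (ord_der _ _ fo (fun x => @ord_linf _ (d x)))); lia. Qed.

Lemma dlinB f g : dlin (f - g) = dlin f - dlin g. Proof. exact: derB. Qed.
Lemma dlinD f g : dlin (f + g) = dlin f + dlin g. Proof. exact: derD. Qed.
Lemma dlinZ a f : dlin (a *: f) = a *: dlin f. Proof. exact: derZ. Qed.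

(** If the words of length l of f without a0 have fewer than j + 1 letters in Z,
    then E f - (l - j) f has fewer than j of them. It is a cycle to the order considered,
    hence a boundary d v by induction, and so is E f = d S f, which gives f. *)
Theorem contraction k l f : admissible k f -> ord_ge l f -> ord_ge l.+1 (dlin f) ->
    (forall w, size w = l -> all Z w -> f w = 0) ->
  exists v, [/\ admissible (k + 1) v, ord_ge l v & ord_ge l.+1 (f - dlin v)].
Proof.
move=> fk fl dfl fZ.
suff step j : (j <= l)%N -> forall f, admissible k f -> ord_ge l f ->
    ord_ge l.+1 (dlin f) ->
    (forall w, size w = l -> a0 \notin w -> (j <= count Z w)%N -> f w = 0) ->
  exists v, [/\ admissible (k + 1) v, ord_ge l v & ord_ge l.+1 (f - dlin v)].
  apply: (step l) => // w wl _ lZ; apply: fZ => //.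
  by rewrite all_count eqn_leq count_size wl.
elim: j => {f fk fl dfl fZ} [_|j IH jl] f fk fl dfl fZ.
  (* No word without a0 is left, so f vanishes in length l by invariance. *)
  exists 0; split=> //; first exact: admissible0.
  rewrite /dlin linear0 subr0 => w; rewrite ltnS leq_eqVlt => /orP[/eqP wl|]; last exact: fl.
  case: fk => _ fi _; apply: (inv_eq0 va fi) wl => v vl av; exact: fZ.
pose g := elin f - (l - j)%:R *: f.
have [||||v [vk vl gv]] := IH (ltnW jl) g.
- by apply: admissibleB; [exact: admissible_elin | exact: admissibleZ].
- by apply: ordB; [exact: ord_elin | exact: ordZ].
- rewrite /g dlinB dlinZ elinE dlinD dlin_sqr add0r.
  by apply: ordB; [apply/ord_dlin/ord_slin | exact: ordZ].
- move=> w wl aw jZ; rewrite /g seriesB seriesZ elin_diag //.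
  + have [jZ'|Zj] := ltnP j (count Z w); first by rewrite (fZ w) // !mulr0 subrr.
    by rewrite wl (_ : count Z w = j) ?subrr //; apply/eqP; rewrite eqn_leq Zj jZ.
  + by case: fk.
  + by move=> v vw av cv; apply: fZ; rewrite ?vw // (leq_ltn_trans jZ).
have lj : (l - j)%:R != 0 :> rat by rewrite pnatr_eq0 subn_eq0 -ltnNge.
exists ((l - j)%:R^-1 *: (slin f - v)); split.
- by apply/admissibleZ/admissibleB => //; exact: admissible_slin.
- by apply/ordZ/ordB => //; exact: ord_slin.
have -> : f - dlin ((l - j)%:R^-1 *: (slin f - v)) =
    (l - j)%:R^-1 *: (slin (dlin f) - (g - dlin v)).
  rewrite dlinZ dlinB /g elinE; apply: (scalerI lj).
  rewrite scalerBr !scalerA divff // !scale1r.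
  apply/funext => w; rewrite !(seriesD, seriesN, seriesZ); ring.
by apply/ordZ/ordB => //; exact: ord_slin.
Qed.

End Contraction.
(** * Obstruction theory *)
Section Obstruction.
Variables (X : finType) (dg : X -> int).
Variables (vx : pred X) (a0 : X) (M Z : pred X) (d s : X -> X -> rat).
Hypothesis va : vx a0.
Hypothesis dv : forall x, vx x -> dg x = dg a0.
Hypothesis ddeg : forall x y, d x y != 0 -> dg y = dg x - 1.
Hypothesis sdeg : forall x y, s x y != 0 -> dg y = dg x + 1.
Hypothesis d_inv : forall x, ~~ vx x -> invariant vx (linf (d x)).
Hypothesis d_vx : forall x y, vx x -> d x y = 0.
Hypothesis s_vx : forall x y, vx y -> s x y = 0.
Hypothesis dM : forall x y, M x -> ~~ M y -> d x y = 0.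
Hypothesis sM : forall x y, M x -> ~~ M y -> s x y = 0.
Hypothesis d_sqr : forall x z, \sum_y d x y * d y z = 0.
Hypothesis Za0 : ~~ Z a0.
Hypothesis homotopy_id : forall x y, M x -> ~~ Z x -> y != a0 ->
  homotopy_coef d s x y = (x == y)%:R.
Hypothesis homotopy_Z : forall x y, M x -> Z x -> Z y -> homotopy_coef d s x y = 0.

Variables (top : X) (eta : X -> series X).

Definition eta_with_top (u : series X) x := if x == top then u else eta x.

Local Notation admissible := (admissible dg vx M).
Local Notation Delta u := (der dg (-1) (eta_with_top u)).

Hypothesis vtop : ~~ vx top.
Hypothesis dM_top : forall y, ~~ M y -> d top y = 0.
Hypothesis eta_lie : forall x, x != top -> lie_series dg (dg x - 1) (eta x).
Hypothesis eta_lin : forall x y, x != top -> eta x [:: y] = d x y.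
Hypothesis eta_inv : forall x, x != top -> ~~ vx x -> invariant vx (eta x).
Hypothesis eta_vx : forall x, vx x -> invariant vx (eta x - eta a0).
Hypothesis eta_M : forall x, x != top -> M x -> supported M (eta x).
Hypothesis eta_sqr : forall u x, admissible (dg top - 1) u -> x != top ->
  Delta u (eta x) = 0.
Hypothesis Z_deg : forall w, (1 < size w)%N -> all Z w -> wdeg dg w != dg top - 2.

Lemma eta_with_top_lie u x : admissible (dg top - 1) u ->
  lie_series dg (dg x - 1) (eta_with_top u x).
Proof. by case=> ul _ _; rewrite /eta_with_top; case: eqP => [->//|/eqP]; exact: eta_lie. Qed.

Lemma eta_with_top_ord u x : admissible (dg top - 1) u -> ord_ge 1 (eta_with_top u x).
Proof. by move=> gu; apply: lie_series_ord; exact: eta_with_top_lie. Qed.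

Lemma admissible_Delta k u f : admissible (dg top - 1) u -> admissible k f ->
  admissible (k - 1) (Delta u f).
Proof.
move=> gu [fl fi fM]; have [ul ui uM] := gu; split.
- by apply: lie_series_der fl => x; exact: eta_with_top_lie.
- apply: (@inv_der _ _ vx a0 _ (eta_with_top u) _ va dv _ _ fi) => x vxx; rewrite /eta_with_top.
    by case: eqP => [//|/eqP]; move/eta_inv; exact.
  have vx_top y : vx y -> (y == top) = false.
    by move=> vy; apply: contraNF vtop => /eqP <-.
  by rewrite !vx_top //; exact: eta_vx.
- apply: supp_der fM => x Mx; rewrite /eta_with_top.
  by case: eqP => [//|/eqP xt]; exact: eta_M.
Qed.

Lemma d_top_top : d top top = 0.
Proof.
by apply/eqP/negPn/negP => /ddeg; lia.
Qed.

Definition lin_d_top u := forall y, u [:: y] = d top y.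

(** On letters Delta and the linear differential agree up to words of length 2. *)
Lemma Delta_leading u f l : admissible (dg top - 1) u -> lin_d_top u ->
  ord_ge l f -> ord_ge l.+1 (Delta u f - dlin dg d f).
Proof.
move=> gu ulin fl; rewrite /dlin -derBl.
apply: ord_le (ord_der (b := 2) _ _ fl _); first by case: l {fl} => *; lia.
move=> x; rewrite (_ : linf (d x) = linf (fun y => eta_with_top u x [:: y])).
  by apply: ord2_sub_linf; apply: eta_with_top_ord.
congr linf; apply/funext => y; rewrite /eta_with_top.
by case: eqP => [->|/eqP xt]; rewrite ?ulin // eta_lin.
Qed.

(** Terms of f of length at least 2 gain at least one letter around z, and the linear
    part of f contributes nothing. *)
Lemma top_derivation_ord e (z f : series X) l :
    f [::] = 0 -> f [:: top] = 0 -> ord_ge l z ->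
  ord_ge l.+1 (der dg e (fun x => if x == top then z else 0) f).
Proof.
move=> f0 ft zl; set eta' := fun x => _.
have -> : f = linf (fun x => f [:: x]) + (f - linf (fun x => f [:: x])).
  by rewrite addrC subrK.
rewrite derD der_linf (bigD1 top) //= big1 => [|x /negPf xt]; last first.
  by rewrite /eta' xt scaler0.
rewrite ft scale0r !add0r.
apply: ord_le (ord_der (b := l) _ _ (ord2_sub_linf f0) _) => //.
by move=> x; rewrite /eta'; case: eqP => // _; exact: ord_ge0.
Qed.

(** Let z = Delta u have order l. Then d z has order l + 1: it is the leading term of
    Delta z = Delta (Delta u), and Delta Delta is the derivation that kills all
    letters but top, which it maps to z. By the degree hypothesis on Z the contraction
    applies and gives v with d v = z in length l. Replacing u by u - v changes
    Delta u by d v, up to order l + 1. *)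
Theorem obstruction_theory : exists u,
  [/\ admissible (dg top - 1) u, lin_d_top u & Delta u u = 0].
Proof.
pose P N u := [/\ admissible (dg top - 1) u, lin_d_top u & ord_ge N.+2 (Delta u u)].
have lin_u u : admissible (dg top - 1) u -> u [::] = 0.
  by case=> /lie_series_ord ul _ _; exact: ul.
have [u uP] : exists u, forall N, exists2 v, P N v & ord_ge N (u - v).
  apply: (@iterative_correction _ P (linf (d top))).
    have gt : admissible (dg top - 1) (linf (d top)).
      split; [exact: lie_d | exact: d_inv | exact: supp_linf].
    split=> //; first by move=> y; rewrite linf_letter.
    have lt : lin_d_top (linf (d top)) by move=> y; rewrite linf_letter.
    have := Delta_leading gt lt (@ord_linf _ (d top)).
    by rewrite /dlin [X in _ - X]der_linf linf_comp [X in _ - X]linf0 ?subr0.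
  move=> N u [gu ulin uN]; set z := Delta u u in uN.
  have gz : admissible (dg top - 2) z.
    by have := admissible_Delta gu gu; rewrite -addrA.
  have dz : ord_ge N.+3 (dlin dg d z).
    have -> : dlin dg d z = Delta u z - (Delta u z - dlin dg d z).
      by rewrite opprB addrC subrK.
    apply: ordB; last exact: Delta_leading.
    rewrite /z der_sqr => [|x]; last exact/lie_series_homog/eta_with_top_lie.
    rewrite (_ : (fun x => _) = (fun x => if x == top then z else 0)).
      by apply: top_derivation_ord; rewrite ?lin_u // ulin d_top_top.
    apply/funext => x; rewrite {2}/eta_with_top; case: eqP => [//|/eqP xt].
    exact: eta_sqr.
  have [v [gv vN zv]] : exists v, [/\ admissible (dg top - 2 + 1) v, ord_ge N.+2 v
      & ord_ge N.+3 (z - dlin dg d v)].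
    apply: (@contraction _ _ vx a0 M Z d s) => // w wN wZ.
    have [zl _ _] := gz; apply/eqP/negPn/negP => /(lie_series_homog zl)/eqP.
    by apply/negP/Z_deg; rewrite ?wN.
  have {}gv : admissible (dg top - 1) v by rewrite -addrA in gv.
  (* Passing from u to u - v also changes the derivation Delta itself. *)
  exists v; first by apply: ord_le vN; lia.
  have guv : admissible (dg top - 1) (u - v) by exact: admissibleB.
  have uvlin : lin_d_top (u - v) by move=> y; rewrite seriesB ulin vN // subr0.
  split=> //.
  have -> : Delta (u - v) (u - v) = (z - dlin dg d v) - (Delta u v - dlin dg d v)
      + (Delta (u - v) (u - v) - Delta u (u - v)).
    rewrite [Delta u (u - v)]derB -/z; apply/funext => w.
    by rewrite !(seriesD, seriesN); ring.
  apply: ordD; first by apply: ordB => //; exact: Delta_leading.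
  rewrite -derBl (_ : (fun x => _) = (fun x => if x == top then - v else 0)).
    apply: top_derivation_ord; first exact: lin_u.
      by rewrite uvlin d_top_top.
    by move=> w wN; rewrite seriesN vN ?oppr0.
  apply/funext => x; rewrite /eta_with_top; case: eqP => _; last by rewrite subrr.
  by rewrite addrC addKr.
have gu : admissible (dg top - 1) u.
  split.
  - apply: lie_series_lim => N; have [v [[vl _ _] _ _] uv] := uP N.
    by exists v.
  - move=> p q; have [v [[_ vi _] _ _] uv] := uP (size p + size q).+2.
    rewrite -[RHS](vi p q); apply: eq_bigr => x _; apply/eqP.
    by rewrite -subr_eq0 -seriesB uv // size_cat /=; lia.
  - move=> w wM; have [v [[_ _ vM] _ _] uv] := uP (size w).+1.
    by apply/eqP; rewrite -(vM _ wM) -subr_eq0 -seriesB uv.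
exists u; split=> //.
  move=> y; have [v [_ vlin _] uv] := uP 2.
  by apply/eqP; rewrite -vlin -subr_eq0 -seriesB uv.
apply: ord_all0 => N; have [v [gv _ vN] uv] := uP N.
have -> : Delta u u = Delta v v + Delta u (u - v) + (Delta u v - Delta v v).
  by rewrite derB; apply/funext => w; rewrite !(seriesD, seriesN); ring.
apply: ordD; first apply: ordD.
- by apply: ord_le vN; lia.
- apply: ord_le (ord_der (b := 1) _ _ uv (fun x => eta_with_top_ord x gu)); lia.
- rewrite -derBl; have fo : ord_ge 1 v by case: gv => /lie_series_ord.
  apply: ord_le (ord_der (b := N) _ _ fo _) => // x.
  by rewrite /eta_with_top; case: eqP => // _; rewrite subrr.
Qed.

End Obstruction.

(** * Change of alphabet *)
HB.instance Definition _ (X Y : finType) (phi : X -> Y) :=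
  GRing.isLinear.Build rat (series X) (series Y) *:%R (push phi) (@push_lin X Y phi).

Section PushTheory.
Variables X Y : finType.
Implicit Types f g : series X.

Lemma eq_push (phi psi : X -> Y) f : phi =1 psi -> push phi f = push psi f.
Proof.
move=> e; apply/funext => w; apply: eq_bigl => u.
by rewrite (eq_map e).
Qed.

Lemma push_id (T : finType) (f : series T) : push id f = f.
Proof.
apply/funext => w; rewrite /push (big_pred1 (in_tuple w)) // => u.
by rewrite map_id.
Qed.

Lemma push_sder (phi : X -> Y) f y :
  sder y (push phi f) = \sum_(x | phi x == y) push phi (sder x f).
Proof. by apply/funext => w; rewrite /sder push_cons series_sum. Qed.

Lemma push_comp (T : finType) (phi : X -> Y) (psi : Y -> T) f :
  push psi (push phi f) = push (psi \o phi) f.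
Proof.
apply/funext => w; elim: w f => [|z w IH] f; first by rewrite !push_nil.
rewrite !push_cons (partition_big phi (fun y => psi y == z)) //=.
apply: eq_bigr => y yz; rewrite push_sder linear_sum series_sum.
apply: eq_big => [x|x _]; last exact: IH.
by case: eqP => [->|]; rewrite ?yz ?andbF.
Qed.

Lemma push_letter1 (phi : X -> Y) f y : push phi f [:: y] = \sum_(x | phi x == y) f [:: x].
Proof. by rewrite push_cons; apply: eq_bigr => x _; rewrite push_nil. Qed.

Lemma supp_push (phi : X -> Y) (P : pred Y) f : (forall x, P (phi x)) ->
  supported P (push phi f).
Proof.
move=> Pphi w wP; rewrite /push big1 // => u /eqP uw; case/negP: wP.
by rewrite -uw; apply/allP => _ /mapP[x _ ->].
Qed.

Lemma inv_push (phi : X -> Y) (vX : pred X) (vY : pred Y) f :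
  (forall x, vY (phi x) = vX x) -> invariant vX f -> invariant vY (push phi f).
Proof.
move=> v fi p s; elim: p f fi => [|y p IH] f fi /=; under eq_bigr do rewrite push_cons.
  transitivity (\sum_(x | vX x) push phi (sder x f) s).
    rewrite (partition_big phi vY) => [|x] /=; last by rewrite v.
    apply: eq_bigr => y vy; apply: eq_bigl => x.
    by case: eqP => [xy|]; rewrite ?andbF // -v xy vy.
  rewrite -[LHS](series_sum _ _ (fun x => push phi (sder x f))).
  by rewrite -linear_sum inv_sum_sder // linear0.
rewrite exchange_big big1 // => x _; apply: IH; exact: inv_sder.
Qed.

Variables (dX : X -> int) (dY : Y -> int).

Lemma push_der e (phi : X -> Y) etaX etaY f :
    (forall x, dY (phi x) = dX x) ->
    (forall x, etaY (phi x) = push phi (etaX x)) ->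
  push phi (der dX e etaX f) = der dY e etaY (push phi f).
Proof.
move=> dphi ephi; apply/eqP; rewrite -subr_eq0; apply/eqP.
pose q y f : series X := \sum_(x | phi x == y) sder x f.
have pq y g : sder y (push phi g) = push phi (q y g) by rewrite push_sder /q linear_sum.
apply: (@shift_recursion0 Y _ (fun f => push phi (der dX e etaX f) -
  der dY e etaY (push phi f)) (fun _ y => ksign (e * dY y)) q) => {}f.
have -> : push phi (der dX e etaX f) = \sum_y (smul (etaY y) (push phi (q y f)) +
    ksign (e * dY y) *: smul (letter y) (push phi (der dX e etaX (q y f)))).
  rewrite derE linear_sum (partition_big phi xpredT) //=; apply: eq_bigr => y _.
  rewrite /q !linear_sum -big_split; apply: eq_bigr => x /eqP <- /=.
  by rewrite linearD linearZ_LR /= !push_smul push_letter dphi ephi.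
rewrite [der dY e etaY (push phi f)]derE -sumrB; apply: eq_bigr => y _.
rewrite pq smulBr scalerBr.
apply/funext => w; rewrite !(seriesD, seriesN); ring.
Qed.

End PushTheory.
(** * The simplicial chain complex and its cone contraction *)
Section SimplexCombinatorics.
Variable n : nat.
Implicit Types (A B C : face n) (S T : {set 'I_n.+1}) (i j : 'I_n.+1).

Definition rank S i : nat := #|[set j in S | (j < i)%N]|.

(** Incidence numbers on all subsets: keeping the empty set as a possible value of T
    avoids the case distinction of [simplicial_d]. *)
Definition dset S T : rat := \sum_(i in S) (-1) ^+ rank S i * (T == S :\ i)%:R.

Definition mkface S (S0 : S != set0) : face n := exist _ S S0.

Definition dcoef A B : rat := dset (val A) (val B).

Lemma sum_face S (F : face n -> rat) (F' : {set 'I_n.+1} -> rat) :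
    (forall A, F A = F' (val A)) ->
  \sum_A (val A == S)%:R * F A = (S != set0)%:R * F' S.
Proof.
move=> FF'; have [->|S0] := eqVneq S set0.
  by rewrite mul0r big1 // => A _; rewrite (negPf (valP A)) mul0r.
rewrite (bigD1 (mkface S0)) //= eqxx FF' big1 ?addr0 // => A.
by rewrite -val_eqE /= => /negPf ->; rewrite mul0r.
Qed.

Lemma dset_neq0 S T : dset S T != 0 -> exists2 i, i \in S & T = S :\ i.
Proof.
move=> nz; apply: contrapT => H; case/eqP: nz; rewrite /dset big1 // => i iS.
by case: eqP => [TE|]; rewrite ?mulr0 //; case: H; exists i.
Qed.

Lemma dcoef_deg A B : dcoef A B != 0 -> face_deg B = face_deg A - 1.
Proof.
case/dset_neq0 => i iA BE; rewrite /face_deg BE (cardsD1 i (val A)) iA; lia.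
Qed.

Lemma dcoef_top A : dcoef A (top n) = 0.
Proof.
apply/eqP/negPn/negP => /dset_neq0[i iA] /setP/(_ i).
by rewrite !inE eqxx.
Qed.

Definition is_vertex A := #|val A| == 1.

Lemma is_vertexP A : reflect (exists i, A = vertex i) (is_vertex A).
Proof.
apply: (iffP cards1P) => [[i AE]|[i ->]]; last by exists i.
by exists i; apply: val_inj.
Qed.

Lemma vertexP i : is_vertex (vertex i).
Proof. by apply/is_vertexP; exists i. Qed.

Lemma vertex_deg A : is_vertex A -> face_deg A = -1.
Proof. by rewrite /is_vertex /face_deg => /eqP ->. Qed.

Lemma dcoef_vertex A B : is_vertex A -> dcoef A B = 0.
Proof.
case/is_vertexP => i ->; apply/eqP/negPn/negP => /dset_neq0[j].
rewrite inE => /eqP -> BE; case/negP: (valP B).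
by rewrite BE; apply/eqP/setP => k; rewrite !inE andNb.
Qed.

Lemma rank_pair i j : (i < j)%N -> rank [set i; j] i = 0%N /\ rank [set i; j] j = 1%N.
Proof.
move=> ij; rewrite /rank; split.
  apply: eq_card0 => k; rewrite !inE.
  by apply/negP => /andP[/orP[/eqP ->|/eqP ->]]; lia.
rewrite (_ : [set _ in _ | _] = [set i]) ?cards1 //; apply/setP => k; rewrite !inE.
case: (k =P i) => [->|_] /=; first by rewrite ij.
by case: eqP => [->|]; rewrite ?ltnn.
Qed.

(** Only an edge has vertices in its boundary, and they come with opposite signs. *)
Lemma dcoef_inv A : ~~ is_vertex A -> invariant is_vertex (linf (dcoef A)).
Proof.
move=> nvA; apply: inv_linf.
have [A2|A2] := eqVneq #|val A| 2; last first.
  rewrite big1 // => B /eqP B1; apply/eqP/negPn/negP => /dcoef_deg.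
  by rewrite /face_deg B1 => AE; case/eqP: A2; lia.
transitivity (\sum_(i in val A) (-1) ^+ rank (val A) i : rat).
  rewrite /dcoef /dset exchange_big; apply: eq_bigr => i iA /=.
  have A1 : #|val A :\ i| == 1 by move: A2; rewrite (cardsD1 i (val A)) iA; lia.
  have A0 : val A :\ i != set0 by rewrite -card_gt0 (eqP A1).
  rewrite (bigD1 (mkface A0)) //= eqxx mulr1 big1 ?addr0 // => B.
  by rewrite -val_eqE /= => /andP[_ /negPf ->]; rewrite mulr0.
move/eqP/cards2P: A2 => [i [j [ij ->]]].
wlog lij : i j ij / (i < j)%N.
  move=> H; have [lij|lji|/val_inj eij] := ltngtP i j; first exact: H.
    by rewrite setUC; apply: H => //; rewrite eq_sym.
  by rewrite eij eqxx in ij.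
have [ri rj] := rank_pair lij.
rewrite (big_setD1 i) ?inE ?eqxx //= ri (_ : [set i; j] :\ i = [set j]).
  by rewrite big_set1 rj expr0 expr1 subrr.
by rewrite setU1K // inE.
Qed.

(** Removing i and then j, or j and then i, gives opposite signs. *)
Lemma dcoef_sqr A C : \sum_B dcoef A B * dcoef B C = 0.
Proof.
pose t i j : rat := (j != i)%:R * ((-1) ^+ rank (val A) i *
  ((-1) ^+ rank (val A :\ i) j * (val C == val A :\ i :\ j)%:R)).
have -> : \sum_B dcoef A B * dcoef B C = \sum_(i in val A) \sum_(j in val A) t i j.
  rewrite /dcoef; under eq_bigr do rewrite /dset big_distrl.
  rewrite exchange_big; apply: eq_bigr => i iA /=.
  under eq_bigr do rewrite -mulrA.
  rewrite -big_distrr (sum_face _ (F' := fun S => dset S (val C))) //=.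
  have -> : dset (val A :\ i) (val C) = \sum_(j in val A) (j != i)%:R *
      ((-1) ^+ rank (val A :\ i) j * (val C == val A :\ i :\ j)%:R).
    rewrite /dset [RHS](bigID (fun j => j != i)) /= [X in _ + X]big1 ?addr0.
      by apply: eq_big => j; rewrite !inE 1?andbC // => /andP[_ ->]; rewrite mul1r.
    by move=> j /andP[_ /negPf ->]; rewrite mul0r.
  rewrite /t mulr_sumr mulr_sumr; apply: eq_bigr => j jA.
  have [->|ji] := eqVneq j i; first by rewrite !mul0r !mulr0.
  have -> : (val A :\ i != set0).
    by apply/set0Pn; exists j; rewrite !inE ji.
  by rewrite !mul1r.
have tN i j : i \in val A -> j \in val A -> t i j = - t j i.
  move=> iA jA; rewrite /t eq_sym; have [_|ij] := eqVneq i j.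
    by rewrite !mul0r oppr0.
  rewrite !mul1r (_ : val A :\ i :\ j = val A :\ j :\ i); last by rewrite setDDl setDDl setUC.
  have rD k l : k \in val A -> rank (val A) l = ((k < l) + rank (val A :\ k) l)%N.
    move=> kA; rewrite /rank (cardsD1 k) !inE kA /=; congr (_ + _)%N.
    by apply: eq_card => m; rewrite !inE andbA.
  rewrite (rD j i jA) (rD i j iA).
  case: (ltngtP i j) ij => [ij|ji|/val_inj ->]; last by rewrite eqxx.
  - by move=> _; rewrite add0n add1n exprS; ring.
  - by move=> _; rewrite add0n add1n exprS; ring.
suff : \sum_(i in val A) \sum_(j in val A) t i j =
  - \sum_(i in val A) \sum_(j in val A) t i j by lra.
rewrite {1}exchange_big -sumrN; apply: eq_bigr => i iA; rewrite -sumrN.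
by apply: eq_bigr => j jA; exact: tN.
Qed.

Lemma top_vertex : (0 < n)%N -> ~~ is_vertex (top n).
Proof. by rewrite /is_vertex /= cardsT card_ord; lia. Qed.

(** For n > 1 the top face is forbidden, as inductivity demands. For n = 1 it is needed:
    D a_01 involves a_01. *)
Definition allowed S := (n == 1%N) || (S != [set: 'I_n.+1]).
Definition allowed_face A := allowed (val A).
(** For n > 1 this holds for the face {1, ..., n} only. *)
Definition blocked_face A := (ord0 \notin val A) && ~~ allowed (ord0 |: val A).
Definition scoef A B : rat :=
  ((ord0 \notin val A) && allowed (ord0 |: val A))%:R * (val B == ord0 |: val A)%:R.

Lemma scoef_neq0 A B : scoef A B != 0 ->
  [/\ ord0 \notin val A, allowed (ord0 |: val A) & val B = ord0 |: val A].
Proof.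
by rewrite /scoef -natrM mulnb pnatr_eq0 eqb0 negbK => /andP[/andP[? ?] /eqP].
Qed.

Lemma scoef_deg A B : scoef A B != 0 -> face_deg B = face_deg A + 1.
Proof.
by case/scoef_neq0 => A0 _ BE; rewrite /face_deg BE cardsU1 A0; lia.
Qed.

Lemma scoef_vertex A B : is_vertex B -> scoef A B = 0.
Proof.
move=> B1; apply/eqP/negPn/negP => /scoef_neq0[A0 _ BE].
move: B1; rewrite /is_vertex BE cardsU1 A0 add1n eqSS cards_eq0.
by rewrite (negPf (valP A)).
Qed.

Lemma dcoef_M A B : ~~ allowed_face B -> dcoef A B = 0.
Proof.
rewrite /allowed_face /allowed negb_or negbK => /andP[_ /eqP BE].
by rewrite -(dcoef_top A) /dcoef BE.
Qed.

Lemma scoef_M A B : ~~ allowed_face B -> scoef A B = 0.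
Proof.
move=> MB; apply/eqP/negPn/negP => /scoef_neq0[_ M0 BE].
by case/negP: MB; rewrite /allowed_face BE.
Qed.

Lemma blocked_face_base : ~~ blocked_face (vertex ord0).
Proof. by rewrite /blocked_face /= inE eqxx. Qed.

Lemma homotopy_coef_Z A B : allowed_face A -> blocked_face A -> blocked_face B ->
  homotopy_coef dcoef scoef A B = 0.
Proof.
move=> _ /andP[_ MA] /andP[B0 _]; rewrite /homotopy_coef big1 // => C _.
rewrite {1}/scoef (negPf MA) andbF !mul0r add0r.
have [->|/scoef_neq0[_ _ BE]] := eqVneq (scoef C B) 0; first by rewrite mulr0.
by rewrite BE !inE eqxx in B0.
Qed.

Lemma sum_dcoef A (F : face n -> rat) (F' : {set 'I_n.+1} -> rat) :
    (forall A, F A = F' (val A)) ->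
  \sum_C dcoef A C * F C =
  \sum_(i in val A) (-1) ^+ rank (val A) i * ((val A :\ i != set0)%:R * F' (val A :\ i)).
Proof.
move=> FF'; rewrite /dcoef /dset; under eq_bigr do rewrite big_distrl.
rewrite exchange_big; apply: eq_bigr => i iA /=.
by under eq_bigr do rewrite -mulrA; rewrite -big_distrr (sum_face _ FF').
Qed.

Lemma rank0 S : rank S ord0 = 0%N.
Proof. by apply: eq_card0 => k; rewrite !inE ltn0 andbF. Qed.

(** The usual computation for a cone: removing the apex from the cone over A gives A
    back, with sign +1 since the apex comes first, and the other terms cancel. The
    case of a vertex A, whose boundary has no cone, produces the apex itself. *)
Lemma homotopy_coef_id A B : allowed_face A -> ~~ blocked_face A -> B != vertex ord0 ->
  homotopy_coef dcoef scoef A B = (A == B)%:R.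
Proof.
move=> MA ZA B0; rewrite /homotopy_coef big_split /=.
have vB S : S = [set ord0] -> (val B == S) = false.
  by move=> ->; apply: contra_neqF B0 => /eqP BE; apply: val_inj.
pose s' S : rat := ((ord0 \notin S) && allowed (ord0 |: S))%:R * (val B == ord0 |: S)%:R.
rewrite (sum_dcoef _ (F' := s')) // eq_sym -val_eqE /=.
have [A0|A0] := boolP (ord0 \in val A).
  rewrite big1 => [|C _]; last by rewrite /scoef A0 mul0r mul0r.
  rewrite add0r (big_setD1 ord0) //= big1 ?addr0 => [|i]; last first.
    rewrite in_setD1 => /andP[i0 _].
    have h : ord0 \in val A :\ i by rewrite in_setD1 A0 eq_sym i0.
    by rewrite /s' h !mul0r !mulr0.
  rewrite rank0 mul1r /s' !inE eqxx setD1K // [allowed _]MA mul1r.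
  have [AE|] := eqVneq (val A :\ ord0) set0; last by rewrite mul1r.
  by rewrite mul0r vB // -(setD1K A0) AE setU0.
move: ZA; rewrite /blocked_face A0 negbK /= => MA0.
rewrite /scoef A0 MA0 /=; under eq_bigr do rewrite mul1r.
rewrite (sum_face _ (F' := fun S => dset S (val B))) //.
rewrite (_ : ord0 |: val A != set0); last by apply/set0Pn; exists ord0; rewrite !inE eqxx.
rewrite mul1r /dset big_setU1 //= rank0 mul1r setU1K // -addrA -big_split.
rewrite big1 ?addr0 // => i iA /=.
have i0 : i != ord0 by apply: contraNneq A0 => <-.
have -> : (ord0 |: val A) :\ i = ord0 |: (val A :\ i).
  by apply/setP => k; rewrite !inE; have [->|//] := eqVneq k ord0; rewrite /= (eq_sym _ i) i0.
have -> : rank (ord0 |: val A) i = (rank (val A) i).+1.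
  have ipos : (0 < i)%N by rewrite lt0n.
  rewrite /rank (cardsD1 ord0) !inE eqxx /= ipos add1n; congr _.+1.
  apply: eq_card => k; rewrite !inE.
  by case: eqP => [->|] //=; rewrite (negPf A0).
have -> : s' (val A :\ i) = (val B == ord0 |: (val A :\ i))%:R.
  rewrite /s' !inE (negPf A0) andbF /= (_ : allowed _); first by rewrite mul1r.
  rewrite /allowed; apply/orP; right; apply/negP => /eqP/setP/(_ i).
  by rewrite !inE eqxx (negPf i0).
have [AE|_] := eqVneq (val A :\ i) set0; last by rewrite mul1r exprS; ring.
by rewrite vB ?AE ?setU0 // !mulr0 addr0.
Qed.

(** A word of l letters {1, ..., n} has degree l (n - 2), and l > 1. *)
Lemma Z_wdeg (w : seq (face n)) : (0 < n)%N -> (1 < size w)%N -> all blocked_face w ->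
  wdeg (@face_deg n) w != face_deg (top n) - 2.
Proof.
move=> n0 w1 wZ.
have Zd A : blocked_face A -> (1 < n)%N /\ face_deg A = n%:Z - 2.
  case/andP => A0; rewrite /allowed negb_or negbK => /andP[n1 /eqP AE].
  split; first lia.
  by have := cardsU1 ord0 (val A); rewrite AE cardsT card_ord A0 add1n /face_deg => -[<-].
have -> : wdeg (@face_deg n) w = (n%:Z - 2) * (size w)%:Z.
  elim: w {w1} wZ => [|A w IH]; first by rewrite /wdeg big_nil mulr0.
  by case/andP => /Zd[_ dA] /IH; rewrite /wdeg big_cons dA => -> /=; rewrite intS mulrDr mulr1.
have n1 : (1 < n)%N by case: w w1 wZ => // A w _ /andP[/Zd[]].
rewrite /face_deg /= cardsT card_ord; apply/eqP; nia.
Qed.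

Lemma simplicial_dE A : simplicial_d A = \sum_B dcoef A B *: agen B.
Proof.
rewrite /simplicial_d /dcoef /dset; under [RHS]eq_bigr do rewrite scaler_suml.
rewrite exchange_big; apply: eq_bigr => i iA /=.
under eq_bigr do rewrite -scalerA; rewrite -scaler_sumr; congr (_ *: _).
case: insubP => [B _ BE|A0].
  rewrite (bigD1 B) //= -BE eqxx scale1r big1 ?addr0 // => C /negPf CB.
  by rewrite val_eqE CB scale0r.
rewrite big1 // => B _; case: eqP => [BE|]; last by rewrite scale0r.
by case/negP: A0; rewrite -BE; exact: (valP B).
Qed.

End SimplexCombinatorics.
Lemma letter_homog (X : finType) (dg : X -> int) x : shomog dg (dg x) (letter x).
Proof. exact/lie_poly_homog/lie_letter. Qed.
Arguments letter_homog [X] dg x w _.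

(** * Faces as images of simplices *)
Lemma inv_letter (X : finType) (vx : pred X) x : ~~ vx x -> invariant vx (letter x).
Proof.
move=> vx0; rewrite letter_linf; apply: inv_linf; rewrite big1 // => y vy.
by case: eqP vx0 => // <-; rewrite vy.
Qed.

Lemma inv_letterB (X : finType) (vx : pred X) x y : vx x -> vx y ->
  invariant vx (letter x - letter y).
Proof.
move=> vxx vyy; rewrite !letter_linf.
have -> : linf (fun z => (z == x)%:R) - linf (fun z => (z == y)%:R) =
          linf (fun z => (z == x)%:R - (z == y)%:R).
  by rewrite /linf -sumrB; apply: eq_bigr => z _; rewrite scalerBl.
apply: inv_linf; rewrite sumrB (bigD1 x) // (bigD1 y vyy) //= !eqxx.
by rewrite !big1 ?addr0 ?subrr // => z /andP[_ /negPf ->].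
Qed.

Section VertexMaps.
Implicit Types p n : nat.

Fact vmap_proof p n (iota : 'I_p.+1 -> 'I_n.+1) (A : face p) : iota @: val A != set0.
Proof. by case: A => A /= /set0Pn[i iA]; apply/set0Pn; exists (iota i); exact: imset_f. Qed.

Definition vmap p n (iota : 'I_p.+1 -> 'I_n.+1) (A : face p) : face n :=
  mkface (vmap_proof iota A).

Definition increasing p n (iota : 'I_p.+1 -> 'I_n.+1) :=
  forall i j : 'I_p.+1, (i < j)%N -> (iota i < iota j)%N.

Lemma increasing_lt p n (iota : 'I_p.+1 -> 'I_n.+1) (i j : 'I_p.+1) :
  increasing iota -> (iota i < iota j)%N = (i < j)%N.
Proof.
move=> inc; have [/inc //|/inc|/val_inj ->] := ltngtP i j; last by rewrite ltnn.
by move=> ji; apply/negbTE; rewrite -leqNgt ltnW.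
Qed.

Lemma increasing_inj p n (iota : 'I_p.+1 -> 'I_n.+1) : increasing iota -> injective iota.
Proof.
move=> inc i j ij; have [/inc|/inc|/val_inj //] := ltngtP i j; by rewrite ij ltnn.
Qed.

Lemma lift_increasing n (i : 'I_n.+2) : increasing (lift i : 'I_n.+1 -> 'I_n.+2).
Proof. by move=> j k jk; rewrite /= /bump; lia. Qed.

Lemma vmap_comp p q n (iota : 'I_p.+1 -> 'I_q.+1) (kappa : 'I_q.+1 -> 'I_n.+1) :
  vmap kappa \o vmap iota =1 vmap (kappa \o iota).
Proof. by move=> A; apply: val_inj; rewrite /= -imset_comp. Qed.

Lemma eq_vmap p n (iota kappa : 'I_p.+1 -> 'I_n.+1) : iota =1 kappa -> vmap iota =1 vmap kappa.
Proof. by move=> e A; apply: val_inj; apply: eq_imset. Qed.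

Lemma vmap_deg p n (iota : 'I_p.+1 -> 'I_n.+1) A : injective iota ->
  face_deg (vmap iota A) = face_deg A.
Proof. by move=> inj; rewrite /face_deg /= card_imset. Qed.

Lemma vmap_vertex p n (iota : 'I_p.+1 -> 'I_n.+1) i : vmap iota (vertex i) = vertex (iota i).
Proof. by apply: val_inj; rewrite /= imset_set1. Qed.

Lemma is_vertex_vmap p n (iota : 'I_p.+1 -> 'I_n.+1) A : injective iota ->
  is_vertex (vmap iota A) = is_vertex A.
Proof. by move=> inj; rewrite /is_vertex /= card_imset. Qed.

Lemma sorted_enum_ord n (S : {set 'I_n}) : sorted (relpre val ltn) (enum S).
Proof.
rewrite {1}/enum_mem; apply: sorted_filter; first by move=> j i k; exact: ltn_trans.
by rewrite -sorted_map -enumT val_enum_ord iota_ltn_sorted.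
Qed.

(* Both sides are sorted and have the same members. *)
Lemma enum_imset_increasing p n (iota : 'I_p.+1 -> 'I_n.+1) (S : {set 'I_p.+1}) :
  increasing iota -> enum (iota @: S) = map iota (enum S).
Proof.
move=> inc; apply: (@irr_sorted_eq _ (relpre val ltn)).
- by move=> j i k; exact: ltn_trans.
- by move=> i; exact: ltnn.
- exact: sorted_enum_ord.
- rewrite sorted_map; apply: sub_sorted (sorted_enum_ord S) => i j /=.
  by rewrite increasing_lt.
move=> i; rewrite mem_enum; apply/imsetP/mapP => -[j jS ->]; exists j => //.
  by rewrite mem_enum.
by rewrite mem_enum in jS.
Qed.

(* The vertices of A in increasing order. *)
Definition vertex_enum n (A : face n) p (i : 'I_p.+1) : 'I_n.+1 := nth ord0 (enum (val A)) i.

Lemma card_face n (A : face n) : #|val A| = #|val A|.-1.+1.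
Proof. by rewrite prednK // card_gt0 (valP A). Qed.

Lemma vertex_enum_increasing n (A : face n) : increasing (@vertex_enum n A #|val A|.-1).
Proof.
move=> i j ij; apply: (sorted_ltn_nth (leT := relpre val ltn)) ij.
- by move=> ? ? ?; exact: ltn_trans.
- exact: sorted_enum_ord.
- by rewrite inE -cardE; apply: leq_trans (ltn_ord _) _; rewrite -card_face.
- by rewrite inE -cardE; apply: leq_trans (ltn_ord _) _; rewrite -card_face.
Qed.

Lemma vertex_enum_top n (A : face n) : vmap (@vertex_enum n A #|val A|.-1) (top _) = A.
Proof.
apply: val_inj; apply/setP => i; apply/imsetP/idP => [[j _ ->]|iA].
  rewrite -mem_enum; apply: mem_nth; rewrite -cardE; apply: leq_trans (ltn_ord _) _.
  by rewrite -card_face.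
have ilt : (index i (enum (val A)) < #|val A|.-1.+1)%N.
  by rewrite -card_face cardE index_mem mem_enum.
by exists (Ordinal ilt); rewrite ?inE // /vertex_enum /= nth_index ?mem_enum.
Qed.

Lemma vertex_enum_vmap p n q (iota : 'I_p.+1 -> 'I_n.+1) (A : face p) : increasing iota ->
  (q < #|val A|)%N ->
  @vertex_enum n (vmap iota A) q =1 iota \o @vertex_enum p A q.
Proof.
move=> inc qA i; rewrite /vertex_enum /= enum_imset_increasing // (nth_map ord0) //.
by rewrite -cardE; apply: leq_trans (ltn_ord i) qA.
Qed.

Lemma vertex_enum_id n : @vertex_enum n (top n) n =1 id.
Proof. by move=> i; rewrite /vertex_enum /= enum_setT -enumT nth_ord_enum. Qed.

(** Increasing maps preserve the position of a vertex in a face, hence the signs. *)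
Lemma dcoef_vmap p n (iota : 'I_p.+1 -> 'I_n.+1) (A : face p) (B : face n) :
  increasing iota -> \sum_(C | vmap iota C == B) dcoef A C = dcoef (vmap iota A) B.
Proof.
move=> inc; have inj := increasing_inj inc.
rewrite big_mkcond (eq_bigr (fun C => dcoef A C * (iota @: val C == val B)%:R)); last first.
  by move=> C _; rewrite -val_eqE /=; case: eqP; rewrite ?mulr1 ?mulr0.
rewrite (sum_dcoef _ (F' := fun S => (iota @: S == val B)%:R)) // /dcoef /dset.
rewrite big_imset /=; last by move=> i j _ _; exact: inj.
apply: eq_bigr => i iA.
have imD : iota @: val A :\ iota i = iota @: (val A :\ i).
  apply/setP => k; rewrite in_setD1; apply/andP/imsetP => [[ki /imsetP[j jA kE]]|[j]].
    by exists j; rewrite // in_setD1 jA andbT; apply: contraNneq ki => <-; rewrite kE.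
  by rewrite in_setD1 => /andP[ji jA] ->; rewrite (inj_eq inj) ji; split; rewrite ?imset_f.
have -> : rank (iota @: val A) (iota i) = rank (val A) i.
  rewrite /rank -(card_imset _ inj); apply: eq_card => k; rewrite inE.
  apply/andP/imsetP => [[/imsetP[j jA ->]]|[j]].
    by rewrite increasing_lt // => ji; exists j; rewrite // inE jA.
  by rewrite inE => /andP[jA ji] ->; split; [exact: imset_f | rewrite increasing_lt].
rewrite imD [sval B == _]eq_sym; have [->|_] := eqVneq (sval A :\ i) set0; last by rewrite mul1r.
by rewrite imset0 eq_sym (negPf (valP B)) mul0r.
Qed.

End VertexMaps.

(** * Families of differentials *)
Section Families.
Implicit Types (t : forall p, series (face p)) (n p : nat).

(** The differential of a_A prescribed by the family t, for t_p the differential of the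
    top generator of the p-simplex. *)
Definition face_boundary t n (A : face n) : series (face n) :=
  push (vmap (@vertex_enum n A #|val A|.-1)) (t #|val A|.-1).

Definition family_der t n : series (face n) -> series (face n) :=
  der (@face_deg n) (-1) (@face_boundary t n).

Definition base n : series (face n) := letter (vertex (ord0 : 'I_n.+1)).

Arguments base : clear implicits.

Definition twisted t n : series (face n) :=
  t n + sbr (@face_deg n) (base n) (letter (top n)).

Arguments twisted : clear implicits.

(** The requirements on t_n, given t_p for p < n. For n > 0 the invariant one is the
    series called u above, that is, the twisted differential of the top generator. *)
Definition coherent_at t n :=
  [/\ n = 0%N -> t n = - smul (base n) (base n),
      lie_series (@face_deg n) (face_deg (top n) - 1) (t n),
      forall B, t n [:: B] = dcoef (top n) B,
      (0 < n)%N -> invariant (@is_vertex n) (twisted t n) /\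
        ((1 < n)%N -> supported (predC1 (top n)) (twisted t n))
    & family_der t (t n) = 0].

Lemma eq_face_boundary t t' n (A : face n) : t #|val A|.-1 = t' #|val A|.-1 ->
  face_boundary t A = face_boundary t' A.
Proof. by rewrite /face_boundary => ->. Qed.

Lemma card_face_le n (A : face n) : (#|val A|.-1 <= n)%N.
Proof.
by rewrite -ltnS -card_face; apply: leq_trans (max_card _) _; rewrite card_ord.
Qed.

Lemma card_face_lt n (A : face n) : A != top n -> (#|val A|.-1 < n)%N.
Proof.
move=> AT; rewrite ltn_neqAle card_face_le andbT; apply: contraNneq AT => An.
apply/eqP/val_inj/eqP; rewrite /= eqEcard subsetT cardsT card_ord /=.
by rewrite card_face An.
Qed.

Lemma card_top n : #|val (top n)|.-1 = n.
Proof. by rewrite /= cardsT card_ord. Qed.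

Lemma face_boundary_top t n : face_boundary t (top n) = t n.
Proof.
rewrite /face_boundary card_top (eq_push _ (eq_vmap (@vertex_enum_id n))).
rewrite (eq_push (psi := id)) ?push_id // => A; apply: val_inj => /=.
by rewrite imset_id.
Qed.

Lemma face_boundary_vmap t p n (iota : 'I_p.+1 -> 'I_n.+1) (A : face p) : increasing iota ->
  face_boundary t (vmap iota A) = push (vmap iota) (face_boundary t A).
Proof.
move=> inc; rewrite /face_boundary push_comp (eq_push _ (vmap_comp _ _)).
rewrite /= (card_imset _ (increasing_inj inc)).
apply/eq_push/eq_vmap/vertex_enum_vmap => //.
by rewrite -card_face.
Qed.

Lemma push_add (X Y : finType) (phi : X -> Y) f g : push phi (f + g) = push phi f + push phi g.
Proof. exact: linearD. Qed.

Lemma push_letter_vmap p n (iota : 'I_p.+1 -> 'I_n.+1) (A : face p) :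
  push (vmap iota) (letter A) = letter (vmap iota A).
Proof. exact: push_letter. Qed.

Lemma push_base p n (iota : 'I_p.+1 -> 'I_n.+1) :
  push (vmap iota) (base p) = letter (vertex (iota ord0)).
Proof. exact: etrans (push_letter_vmap _ _) (congr1 (@letter _) (vmap_vertex _ _)). Qed.

Lemma push_twisted t p n (iota : 'I_p.+1 -> 'I_n.+1) : injective iota ->
  push (vmap iota) (twisted t p) = push (vmap iota) (t p) +
    sbr (@face_deg n) (letter (vertex (iota ord0))) (letter (vmap iota (top p))).
Proof.
move=> inj; have degE C : face_deg (vmap iota C) = face_deg C by exact: vmap_deg.
have brE := push_sbr degE (letter_homog (@face_deg p) (vertex ord0))
  (letter_homog (@face_deg p) (top p)).
rewrite /twisted push_add; congr (_ + _); apply: etrans brE _.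
congr (sbr _ _ _); [exact: push_base | exact: push_letter_vmap].
Qed.

Lemma push_family_der t p n (iota : 'I_p.+1 -> 'I_n.+1) f : increasing iota ->
  push (vmap iota) (@family_der t p f) = family_der t (push (vmap iota) f).
Proof.
move=> inc; apply: push_der => A; first exact/vmap_deg/increasing_inj.
exact: face_boundary_vmap.
Qed.

Variables (t : forall p, series (face p)) (n : nat).
Implicit Types A B : face n.
Local Notation iota_ A := (@vertex_enum n A #|val A|.-1).

Lemma iota_inj A : injective (iota_ A).
Proof. exact/increasing_inj/vertex_enum_increasing. Qed.

Lemma face_deg_top A : face_deg (top #|val A|.-1) = face_deg A.
Proof. by rewrite /face_deg /= cardsT card_ord -card_face. Qed.

Lemma face_boundary_lie A : coherent_at t #|val A|.-1 ->
  lie_series (@face_deg n) (face_deg A - 1) (face_boundary t A).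
Proof.
case=> _ tl _ _ _; rewrite -(face_deg_top A).
apply: push_lie_series tl => B; exact/vmap_deg/iota_inj.
Qed.

Lemma face_boundary_lin A B : coherent_at t #|val A|.-1 -> face_boundary t A [:: B] = dcoef A B.
Proof.
case=> _ _ tc _ _; rewrite /face_boundary push_letter1.
under eq_bigr do rewrite tc.
rewrite dcoef_vmap; last exact: vertex_enum_increasing.
by rewrite vertex_enum_top.
Qed.

Lemma face_boundary_vertex A : is_vertex A -> coherent_at t 0 ->
  face_boundary t A = - smul (letter A) (letter A).
Proof.
case/is_vertexP => i ->; rewrite /face_boundary /= cards1 /= => -[-> // _ _ _ _].
rewrite linearN /= push_smul /base push_letter vmap_vertex.
by rewrite /vertex_enum /= enum_set1.
Qed.

(** Relabelling turns the vertex 0 of the p-simplex into the least vertex of A. *)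
Lemma face_boundary_inv A : ~~ is_vertex A -> coherent_at t #|val A|.-1 ->
  invariant (@is_vertex n)
    (face_boundary t A + sbr (@face_deg n) (letter (vertex (iota_ A ord0))) (letter A)).
Proof.
move=> vA [_ _ _ tinv _]; have A1 : (0 < #|val A|.-1)%N.
  by move: vA; rewrite /is_vertex -ltnS -card_face; have := card_face A; lia.
have := inv_push (phi := vmap (iota_ A)) (fun C => is_vertex_vmap C (@iota_inj A))
  (proj1 (tinv A1)).
rewrite (push_twisted _ (@iota_inj A)) vertex_enum_top; exact.
Qed.

Lemma face_boundary_supp A : A != top n -> supported (predC1 (top n)) (face_boundary t A).
Proof.
move=> AT; apply: supp_push => C; apply: contraNneq AT => CT.
have : val (vmap (iota_ A) C) \subset val (vmap (iota_ A) (top #|val A|.-1)).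
  exact: imsetS (subsetT _).
rewrite vertex_enum_top CT => AT; apply/eqP/val_inj/eqP.
by rewrite eqEsubset AT subsetT.
Qed.

Lemma family_der_face_boundary A : coherent_at t #|val A|.-1 ->
  family_der t (face_boundary t A) = 0.
Proof.
case=> _ _ _ _ tsqr; rewrite -(push_family_der t (@t _) (@vertex_enum_increasing _ A)) tsqr.
exact: linear0.
Qed.

End Families.
Arguments base : clear implicits.
Arguments twisted : clear implicits.

(** Twisting by a Maurer-Cartan letter a does not change the square of a derivation:
    the correction is the inner derivation by D a + a^2 = 0. *)
Lemma twist_sqr (X : finType) (dg : X -> int) (a x : X) (tau : X -> series X) :
    dg a = -1 -> (forall y, shomog dg (dg y - 1) (tau y)) ->
    tau a = - smul (letter a) (letter a) ->
  let eta y := tau y + sbr dg (letter a) (letter y) in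
  der dg (-1) eta (eta x) = der dg (-1) tau (tau x).
Proof.
move=> da tauh taua eta.
have ah : shomog dg (-1) (letter a) by rewrite -da; exact: letter_homog.
have xh := letter_homog dg x.
have dE f : der dg (-1) eta f = der dg (-1) tau f + sbr dg (letter a) f.
  by rewrite derDl der_ad.
rewrite dE /eta derD -addrA -[RHS]addr0; congr (_ + _).
have taux : shomog dg (dg x - 1) (der dg (-1) tau (letter x)) by rewrite der_letter.
have taua' : shomog dg (- 1 - 1) (der dg (-1) tau (letter a)).
  by rewrite der_letter -{1}da.
rewrite (der_sbr tauh ah xh taua' taux) !der_letter.
have axh := shomog_sbr ah xh.
have aah : shomog dg (-1 - 1) (- smul (letter a) (letter a)) by rewrite -taua -{1}da.
rewrite -[tau x]scale1r sbr_linr !scale1r taua.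
rewrite -[ksign _]/(-1 : rat) scaleN1r.
rewrite (sbrE aah xh) (sbrE ah axh) (sbrE ah xh) !mulrDr !mulrDl !ksignD !mulN1r !ksignN.
rewrite !(smulNl, smulDl, smulBr, smulDr, smulNr, smulZl, smulZr, smulA).
have s1 := ksign_sqr (dg x).
apply/funext => w; rewrite !(seriesD, seriesN, seriesZ, series0).
ring: s1.
Qed.
(** * Inductive choice of the family *)
Section Recursion.
Variable T : nat -> Type.
Implicit Types (t : forall p, T p) (n p : nat).

Definition upd t n (v : T n) p : T p :=
  if @eqP _ n p is ReflectT e then ecast q (T q) e v else t p.

Lemma upd_same t n (v : T n) : upd t v n = v.
Proof. by rewrite /upd; case: eqP => // e; rewrite eq_axiomK. Qed.

Lemma upd_lt t n (v : T n) p : (p < n)%N -> upd t v p = t p.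
Proof. by rewrite /upd; case: eqP => // e pn; exfalso; rewrite e ltnn in pn. Qed.

Lemma course_of_values_choice (R : nat -> (forall p, T p) -> Prop) t0 :
  (forall n t t', (forall p, (p <= n)%N -> t p = t' p) -> R n t -> R n t') ->
  (forall n t, (forall p, (p < n)%N -> R p t) -> exists v : T n, R n (upd t v)) ->
  exists t, forall n, R n t.
Proof.
move=> loc step.
have next n t : {v : T n | (forall p, (p < n)%N -> R p t) -> R n (upd t v)}.
  apply: cid; have [/step[v Rv]|nR] := pselect (forall p, (p < n)%N -> R p t).
    by exists v.
  by exists (t n).
pose fix s n := if n is n'.+1 then upd (s n') (sval (next n' (s n'))) else t0.
have stable n k p : (p < n)%N -> s (n + k)%N p = s n p.
  move=> pn; elim: k => [|k IH]; first by rewrite addn0.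
  by rewrite addnS /= upd_lt ?IH // (leq_trans pn) ?leq_addr.
have sR n p : (p < n)%N -> R p (s n).
  elim: n p => // n IH p; rewrite ltnS leq_eqVlt => /orP[/eqP -> /=|pn].
    by apply: (svalP (next n (s n))) => q; exact: IH.
  apply: loc (IH _ pn) => q qp; rewrite -addn1 stable //.
  exact: leq_ltn_trans qp pn.
exists (fun p => s p.+1 p) => n; apply: loc (sR n.+1 n (ltnSn n)) => p pn.
by rewrite -(subnKC pn) -addSn stable.
Qed.

End Recursion.

Section Construction.
Implicit Types (t : forall p, series (face p)) (n p : nat).

Lemma eq_family_der t t' n f : (forall A : face n, face_boundary t A = face_boundary t' A) ->
  @family_der t n f = @family_der t' n f.
Proof. by move=> tt'; rewrite /family_der; congr (der _ _ _ f); apply/funext. Qed.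

Lemma coherent_at_local n t t' : (forall p, (p <= n)%N -> t p = t' p) ->
  coherent_at t n -> coherent_at t' n.
Proof.
move=> tt'; rewrite /coherent_at /twisted !(tt' n (leqnn n)) (@eq_family_der t t') // => A.
exact/eq_face_boundary/tt'/card_face_le.
Qed.

Lemma coherent_at_below t n (v : series (face n)) : (forall p, (p < n)%N -> coherent_at t p) ->
  forall A, A != top n -> coherent_at (upd t v) #|val A|.-1.
Proof.
move=> tn A /card_face_lt An; apply: coherent_at_local (tn _ An) => p pA.
by rewrite upd_lt // (leq_ltn_trans pA).
Qed.

Lemma base_vertex n : is_vertex (vertex (ord0 : 'I_n.+1)). Proof. exact: vertexP. Qed.

Lemma vertex_neq_top n (A : face n) : (0 < n)%N -> is_vertex A -> A != top n.
Proof. by move=> n0 vA; apply: contraTneq vA => ->; exact: top_vertex. Qed.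

Lemma coherent_at0 t : exists v, coherent_at (upd t (v : series (face 0))) 0.
Proof.
have deg0 : face_deg (vertex (ord0 : 'I_1)) = -1 by rewrite vertex_deg // base_vertex.
have top0 : top 0%N = vertex ord0.
  by apply: val_inj; apply/setP => i; rewrite !inE ord1 eqxx.
have ah : shomog (@face_deg 0%N) (-1) (base 0%N) by rewrite -deg0; exact: letter_homog.
exists (- smul (base 0%N) (base 0%N)); split; rewrite ?upd_same //.
- have -> : - smul (base 0%N) (base 0%N) = - 2^-1 *: sbr (@face_deg 0%N) (base 0%N) (base 0%N).
    rewrite (sbrE ah ah) -[ksign _]/(-1 : rat).
    by apply/funext => w; rewrite !(seriesD, seriesN, seriesZ); field.
  rewrite top0 deg0; apply: lie_seriesZ.
  have bl : lie_series (@face_deg 0%N) (-1) (base 0%N).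
    by rewrite -deg0; exact/lie_poly_series/lie_letter.
  exact: (lie_series_br bl bl).
- move=> B; rewrite top0 dcoef_vertex ?base_vertex // seriesN.
  rewrite (ord_smul (a := 1) (b := 1)) ?oppr0 //; by case.
rewrite /family_der linearN /= derM der_letter -top0 face_boundary_top upd_same.
rewrite (sign_twist_homog _ ah) -[ksign _]/(-1 : rat).
by rewrite smulZl scaleN1r smulNr opprK smulNl smulA addNr oppr0.
Qed.

Section Step.
Variables (t : forall p, series (face p)) (n : nat).
Hypothesis n0 : (0 < n)%N.
Hypothesis tn : forall p, (p < n)%N -> coherent_at t p.
Implicit Types (A B : face n) (u : series (face n)).

Local Notation sbrn := (sbr (@face_deg n)).
Local Notation v0 := (vertex (ord0 : 'I_n.+1)).

Definition step_eta A : series (face n) := face_boundary t A + sbrn (letter v0) (letter A).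

Definition step_family u := upd t (u - sbrn (letter v0) (letter (top n))).

Lemma coherent_below A : A != top n -> coherent_at t #|val A|.-1.
Proof. by move/card_face_lt; exact: tn. Qed.

Lemma v0_deg : face_deg v0 = -1. Proof. exact/vertex_deg/vertexP. Qed.

Lemma v0_top : v0 != top n. Proof. exact/vertex_neq_top/vertexP. Qed.

Lemma v0_lie : lie_series (@face_deg n) (-1) (letter v0).
Proof. by rewrite -v0_deg; exact/lie_poly_series/lie_letter. Qed.

Lemma ad_v0_lie A : lie_series (@face_deg n) (face_deg A - 1) (sbrn (letter v0) (letter A)).
Proof.
by rewrite addrC; apply: lie_series_br v0_lie _; exact/lie_poly_series/lie_letter.
Qed.

Lemma ad_v0_lin A B : sbrn (letter v0) (letter A) [:: B] = 0.
Proof. by rewrite (@ord_sbr _ (@face_deg n) 1 1) //; case. Qed.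

Lemma step_face_boundary u A : A != top n -> face_boundary (step_family u) A = face_boundary t A.
Proof. by move=> AT; apply/eq_face_boundary/upd_lt/card_face_lt. Qed.

Lemma vertex_face_boundary A : is_vertex A -> face_boundary t A = - smul (letter A) (letter A).
Proof. by move=> vA; apply: face_boundary_vertex => //; exact: tn. Qed.

Lemma inv_sbr A B : is_vertex A -> ~~ is_vertex B ->
  invariant (@is_vertex n) (sbrn (letter A - letter v0) (letter B)).
Proof.
move=> vA vB; have Ah : shomog (@face_deg n) (-1) (letter A - letter v0).
  rewrite addrC -scaleN1r; apply: shomog_lin.
    by rewrite -v0_deg; exact: letter_homog.
  by rewrite -(vertex_deg vA); exact: letter_homog.
have Ai : invariant (@is_vertex n) (letter A - letter v0).
  by apply: inv_letterB => //; exact: vertexP.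
rewrite (sbrE Ah (letter_homog _ B)); apply: invB; last apply: invZ.
  by apply: inv_smul => //; exact: inv_letter.
by apply: inv_smul => //; exact: inv_letter.
Qed.

Lemma sbrBl (f g h : series (face n)) : sbrn (f - g) h = sbrn f h - sbrn g h.
Proof. by rewrite addrC -scaleN1r sbr_linl scaleN1r addrC. Qed.

(** For a face A with least vertex m, changing the base point from a_m to a_0 subtracts
    the bracket of a_m - a_0 with a_A, which is invariant. *)
Lemma step_eta_inv A : A != top n -> ~~ is_vertex A -> invariant (@is_vertex n) (step_eta A).
Proof.
move=> AT vA; have := face_boundary_inv vA (coherent_below AT).
set m := vertex _ => mi.
rewrite (_ : step_eta A = face_boundary t A + sbrn (letter m) (letter A)
  - sbrn (letter m - letter v0) (letter A)).
  by apply: invB mi _; apply: inv_sbr => //; exact: vertexP.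
by rewrite sbrBl opprB /step_eta addrA addrAC addrK.
Qed.

Lemma step_eta_vertex A : is_vertex A ->
  step_eta A = - smul (letter A) (letter A) + sbrn (letter v0) (letter A).
Proof. by move=> vA; rewrite /step_eta (vertex_face_boundary vA). Qed.

(** The difference is the Maurer-Cartan term - (a_i - a_0)^2. *)
Lemma step_eta_vx A : is_vertex A -> invariant (@is_vertex n) (step_eta A - step_eta v0).
Proof.
move=> vA; have vv := vertexP (ord0 : 'I_n.+1).
move: (step_eta A) (step_eta v0) (step_eta_vertex vA) (step_eta_vertex vv) => f g -> ->.
have vh := letter_homog (@face_deg n) v0; rewrite v0_deg in vh.
have Ah := letter_homog (@face_deg n) A; rewrite (vertex_deg vA) in Ah.
move: (letter v0) (letter A) (inv_letterB vA vv) vh Ah => x y xyi xh yh.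
rewrite (sbrE xh yh) (sbrE xh xh) -[ksign _]/(-1 : rat).
rewrite (_ : _ - _ = (-1) *: smul (y - x) (y - x)); last first.
  rewrite smulBl !smulBr.
  by apply/funext => w; rewrite !(seriesD, seriesN, seriesZ); ring.
by apply: invZ; exact: inv_smul.
Qed.

Lemma supp_letter (X : finType) (P : pred X) x : P x -> supported P (letter x).
Proof.
move=> Px w; rewrite /letter; case: eqP => // -> /=; by rewrite Px.
Qed.

Lemma ad_v0_supp A : A != top n -> supported (predC1 (top n)) (sbrn (letter v0) (letter A)).
Proof.
move=> AT; have vh := letter_homog (@face_deg n) v0.
rewrite (sbrE vh (letter_homog _ A)) addrC -scaleNr.
have sv : supported (predC1 (top n)) (letter v0) by apply: supp_letter; exact: v0_top.
have sA : supported (predC1 (top n)) (letter A) by exact: supp_letter.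
by apply: supp_lin; exact: supp_smul.
Qed.

Lemma supp_allowed_face (f : series (face n)) :
  supported (predC1 (top n)) f -> supported (@allowed_face n) f.
Proof.
move=> fT w wM; apply: fT; apply: contraNN wM => /allP wT; apply/allP => A /wT /=.
by rewrite /allowed_face /allowed -val_eqE orbC => ->.
Qed.

Lemma allowed_face_supp (f : series (face n)) : (1 < n)%N ->
  supported (@allowed_face n) f -> supported (predC1 (top n)) f.
Proof.
move=> n1 fM w wT; apply: fM; apply: contraNN wT => /allP wM; apply/allP => A /wM.
by rewrite /allowed_face /allowed (gtn_eqF n1) /= -val_eqE.
Qed.

Lemma step_eta_M A : A != top n -> supported (@allowed_face n) (step_eta A).
Proof.
move=> AT; apply: supp_allowed_face; rewrite -[step_eta A]addr0 -[_ + 0]/(_ + 0).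
rewrite addr0 /step_eta -[face_boundary t A]scale1r; apply: supp_lin.
  exact: face_boundary_supp.
exact: ad_v0_supp.
Qed.

Lemma step_eta_top u : eta_with_top (top n) step_eta u =
  (fun A => face_boundary (step_family u) A + sbrn (letter v0) (letter A)).
Proof.
apply/funext => A; rewrite /eta_with_top; case: eqP => [->|/eqP AT].
  by rewrite face_boundary_top /step_family upd_same subrK.
by rewrite step_face_boundary.
Qed.

Lemma step_face_boundary_homog u A : lie_series (@face_deg n) (face_deg (top n) - 1) u ->
  lie_series (@face_deg n) (face_deg A - 1) (face_boundary (step_family u) A).
Proof.
move=> ul; have [->|AT] := eqVneq A (top n).
  by rewrite face_boundary_top /step_family upd_same; apply: lie_seriesB ul _; exact: ad_v0_lie.
by rewrite step_face_boundary //; exact: face_boundary_lie (coherent_below AT).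
Qed.

Lemma step_twist u A : lie_series (@face_deg n) (face_deg (top n) - 1) u ->
  der (@face_deg n) (-1) (eta_with_top (top n) step_eta u) (eta_with_top (top n) step_eta u A) =
  @family_der (step_family u) n (face_boundary (step_family u) A).
Proof.
move=> ul; rewrite step_eta_top; apply: twist_sqr; first exact: v0_deg.
  by move=> B; exact/lie_series_homog/step_face_boundary_homog.
by rewrite step_face_boundary ?v0_top // vertex_face_boundary // vertexP.
Qed.

(** All hypotheses on the faces other than the top one come from smaller simplices. *)
Lemma coherent_at_step : exists v, coherent_at (upd t (v : series (face n))) n.
Proof.
have [u [gu ulin usqr]] : exists u, [/\ admissible (@face_deg n) (@is_vertex n) (@allowed_face n)
    (face_deg (top n) - 1) u, lin_d_top (@dcoef n) (top n) u &
    der (@face_deg n) (-1) (eta_with_top (top n) step_eta u) u = 0].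
  apply: (@obstruction_theory _ _ _ v0 _ (@blocked_face n) _ (@scoef n)).
  - exact: vertexP.
  - by move=> A vA; rewrite v0_deg vertex_deg.
  - exact: dcoef_deg.
  - exact: scoef_deg.
  - exact: dcoef_inv.
  - exact: dcoef_vertex.
  - exact: scoef_vertex.
  - by move=> A B _; exact: dcoef_M.
  - by move=> A B _; exact: scoef_M.
  - exact: dcoef_sqr.
  - exact: blocked_face_base.
  - exact: homotopy_coef_id.
  - exact: homotopy_coef_Z.
  - exact: top_vertex.
  - exact: dcoef_M.
  - move=> A AT; apply: lie_seriesD (ad_v0_lie A).
    exact: face_boundary_lie (coherent_below AT).
  - by move=> A B AT; rewrite /step_eta seriesD ad_v0_lin addr0 face_boundary_lin //;
      exact: coherent_below.
  - exact: step_eta_inv.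
  - exact: step_eta_vx.
  - by move=> A AT _; exact: step_eta_M.
  - move=> u A [ul _ _] AT.
    have -> : step_eta A = eta_with_top (top n) step_eta u A by rewrite /eta_with_top (negPf AT).
    by rewrite step_twist // family_der_face_boundary //; exact: coherent_at_below.
  - by move=> w; exact: Z_wdeg.
have [ul ui uM] := gu.
have uE : twisted (step_family u) n = u by rewrite /twisted /step_family upd_same subrK.
exists (u - sbrn (letter v0) (letter (top n))); rewrite -/(step_family u); split.
- by move=> n00; move: n0; rewrite n00.
- by rewrite /step_family upd_same; apply: lie_seriesB ul (ad_v0_lie _).
- by move=> B; rewrite /step_family upd_same seriesB ulin ad_v0_lin subr0.
- by move=> _; rewrite uE; split=> // n1; exact: allowed_face_supp.
- have := step_twist (top n) ul; rewrite face_boundary_top => <-.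
  by rewrite {2}/eta_with_top eqxx.
Qed.

End Step.
Theorem coherent_family : exists t, forall n, coherent_at t n.
Proof.
apply: (@course_of_values_choice _ (fun n t => coherent_at t n) (fun=> 0)).
  exact: coherent_at_local.
case=> [t _|n t tn]; first exact: coherent_at0.
exact: coherent_at_step.
Qed.

End Construction.
(** * Restriction to the boundary and conclusion *)
Section Restriction.
Variables (X : finType) (dg : X -> int) (P : pred X).
Local Notation Y := {x : X | P x}.
Implicit Types f g : series X.

(** The quotient by the ideal generated by the letters outside P. It shows that a Lie
    series without these letters is a Lie series over P. *)
Definition restrict f : series Y := fun w => f (map val w).

Lemma restrict_lie_poly k f : lie_poly dg k f ->
  lie_poly (fun y : Y => dg (val y)) k (restrict f).
Proof.
elim=> {k f} [x|k|k a f g _ IHf _ IHg|i j f g _ IHf _ IHg].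
- have [Px|Px] := boolP (P x).
    have -> : restrict (letter x) = letter (Sub x Px : Y).
      by apply/funext => w; rewrite /restrict /letter -(inj_eq (inj_map val_inj)).
    exact: (lie_letter (fun y : Y => dg (val y)) (Sub x Px)).
  rewrite (_ : restrict _ = 0); first exact: lie_zero.
  apply/funext => -[|y w] //; rewrite /restrict /letter eqseq_cons.
  by case: eqP => // yx; move: Px; rewrite -yx (valP y).
- exact: lie_zero.
- exact: (lie_lin a IHf IHg).
- have -> : restrict (sbr dg f g) =
      sbr (fun y : Y => dg (val y)) (restrict f) (restrict g).
    apply/funext => w; rewrite /restrict /sbr size_map; apply: eq_bigr => l _.
    by rewrite !map_take !map_drop /wdeg -map_take -map_drop !big_map.
  exact: lie_br.
Qed.

Lemma restrict_hat f : f \in hat_lie dg -> restrict f \in hat_lie (fun y : Y => dg (val y)).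
Proof.
move=> /hat_lieP fL; apply/hat_lieP.
elim: fL => [|a f1 f2 [k f1k] _ IH]; first exact: span_zero.
apply: (span_add a _ IH); exists k => N; have [p [pk fp]] := f1k N.
exists (restrict p); split; first exact: restrict_lie_poly.
by move=> w wN; rewrite /restrict fp // size_map.
Qed.

Lemma push_restrict f : supported P f -> push (val : Y -> X) (restrict f) = f.
Proof.
move=> + ; move=> fP; apply/funext => w; elim: w f fP => [|x w IH] f fP.
  by rewrite push_nil.
rewrite push_cons; have [Px|Px] := boolP (P x); last first.
  rewrite big1 ?fP //= ?(negPf Px) // => y /eqP yx.
  by move: Px; rewrite -yx (valP y).
rewrite (big_pred1 (Sub x Px)) => [|y]; last by rewrite /= -(inj_eq val_inj).
have -> : sder (Sub x Px : Y) (restrict f) = restrict (sder x f).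
  exact/funext.
by rewrite IH //; exact: supp_sder.
Qed.

End Restriction.

Lemma graded_ind (L : graded_lie) (P : L -> Prop) : P 0 ->
  (forall k (a : rat) x y, homog k x -> P y -> P (a *: x + y)) -> forall x, P x.
Proof.
by move=> P0 PS x; elim: (homog_span x) => // a u v [k uk] _; exact: (PS k).
Qed.

Section Model.
Variable t : forall p, series (face p).
Hypothesis tP : forall n, coherent_at t n.
Implicit Type n : nat.

Lemma t_lie n (A : face n) : lie_series (@face_deg n) (face_deg A - 1) (face_boundary t A).
Proof. exact: face_boundary_lie. Qed.

Lemma t_homog n (A : face n) : shomog (@face_deg n) (face_deg A - 1) (face_boundary t A).
Proof. exact/lie_series_homog/t_lie. Qed.

Lemma family_der_hat n (f : series (face n)) :
  f \in hat_lie (@face_deg n) -> @family_der t n f \in hat_lie (@face_deg n).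
Proof.
move=> /hat_lieP fL; apply/hat_lieP; elim: fL => [|a f1 f2 [k f1k] _ IH].
  by rewrite /family_der linear0; exact: span_zero.
rewrite /family_der linearP; apply: span_add IH; exists (k - 1).
by apply: lie_series_der f1k => A; exact: t_lie.
Qed.

Definition Dhat n (f : Lhat n) : Lhat n := HatCar (family_der_hat (serP f)).

Lemma Dhat_lin n : linear (@Dhat n).
Proof. by move=> a f g; apply: val_inj; exact: der_lin. Qed.

Lemma Dhat_differential n : is_differential (@Dhat n).
Proof.
split.
- exact: Dhat_lin.
- by move=> k x xk; apply: lie_series_der xk => A; exact: t_lie.
- move=> k x y xk; elim/graded_ind: y => [|j a y z yj IH].
    apply: val_inj; rewrite /= !sbr0 /family_der linear0 sbr0.
    by rewrite add0r scaler0.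
  apply: val_inj; rewrite /= !sbr_linr /family_der !derD !derZ /=.
  have := congr1 (fun u : Lhat n => ser u) IH; rewrite /= /family_der => ->.
  have xh := lie_series_homog xk; have yh := lie_series_homog yj.
  rewrite (der_sbr (@t_homog n) xh yh (der_homog (@t_homog n) xh) (der_homog (@t_homog n) yh)).
  rewrite mulN1r ksignN sbr_linr.
  by apply/funext => w; rewrite !(seriesD, seriesZ); ring.
- move=> x; apply: val_inj; rewrite /= /family_der der_sqr; last exact: t_homog.
  by apply: der_eq0 => A; exact: family_der_face_boundary.
Qed.

Lemma Dhat_agen n (A : face n) : ser (Dhat (agen A)) = face_boundary t A.
Proof. exact: der_letter. Qed.

Lemma Dhat_vertex n (i : 'I_n.+1) : maurer_cartan (@Dhat n) (agen (vertex i)).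
Proof.
have vh := letter_homog (@face_deg n) (vertex i); rewrite (vertex_deg (vertexP i)) in vh.
split.
  by rewrite -(vertex_deg (vertexP i)); exact/lie_poly_series/lie_letter.
apply: val_inj; rewrite /= /family_der der_letter face_boundary_vertex ?vertexP //.
rewrite (sbrE vh vh) -[ksign _]/(-1 : rat).
by apply/funext => w; rewrite !(seriesD, seriesN, seriesZ, series0); field.
Qed.

Lemma Dhat_linear_part n (A : face n) : linear_part (Dhat (agen A)) = simplicial_d A.
Proof.
rewrite simplicial_dE /linear_part; apply: eq_bigr => B _.
by rewrite Dhat_agen face_boundary_lin.
Qed.

Lemma coface_vmap n (i : 'I_n.+2) : coface i =1 vmap (lift i).
Proof. by move=> A; exact: val_inj. Qed.

Lemma delta_morphism n (i : 'I_n.+2) : dgl_morphism (@Dhat n) (@Dhat n.+1) (@delta n i).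
Proof.
have dlin : linear (@delta n i) by move=> a f g; apply: val_inj; exact: push_lin.
split=> //.
- by move=> k x xk; apply: push_lie_series xk; exact: coface_deg.
- move=> x y; apply: val_inj; rewrite /=.
  elim/graded_ind: x => [|k a x x' xk IHx].
    by rewrite sbr0l linear0 sbr0l.
  rewrite /= !sbr_linl push_lin push_lin sbr_linl IHx; congr (_ *: _ + _).
  elim/graded_ind: y {IHx} => [|j b y y' yj IHy].
    by rewrite sbr0 linear0 sbr0.
  rewrite /= sbr_linr !push_lin sbr_linr IHy; congr (_ *: _ + _).
  exact: push_sbr (@coface_deg n i) _ _ _ _ (lie_series_homog xk) (lie_series_homog yj).
- move=> x; apply: val_inj; rewrite /= !(eq_push _ (coface_vmap i)).
  exact/push_family_der/lift_increasing.
Qed.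

Lemma Dhat_inductive : inductive_models Dhat.
Proof.
move=> n n2; have [_ _ _ tw _] := tP n.
have [_ /(_ n2) supp] := tw (ltnW n2).
set z := twist _ _ _.
have zE : ser z = twisted t n by rewrite /z /twist /= /family_der der_letter face_boundary_top.
have rP := restrict_hat (predC1 (top n)) (serP z).
have sz : supported (predC1 (top n)) (ser z) by rewrite zE.
by exists (HatCar rP); apply/val_inj/esym; exact: push_restrict sz.
Qed.

End Model.

Theorem theorem2p3 :
  exists D : forall n : nat, Lhat n -> Lhat n,
    compatible_models D /\ inductive_models D.
Proof.
have [t tP] := coherent_family; exists (Dhat tP); split; last exact: Dhat_inductive.
split.
- by move=> n; split; [exact: hatL_complete | exact: Dhat_differential].
- exact: Dhat_vertex.
- exact: Dhat_linear_part.
- exact: delta_morphism.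
Qed.
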